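(* Let $q$ be an odd prime power, $\lambda$ a divisor of $q+1$ with $2\le\lambda<q+1$, $m=2t+1\ge5$ with $t$ even, and $n=\frac{q^m+1}{\lambda}$. For an integer $\delta$ with $1\le\delta-1\le\frac{2q^{t+1}+2q-1}{\lambda}$ put $\epsilon=\lceil(\delta-1)(1-q^{-1})\rceil$. Then the LCD BCH code $\mathcal{C}_{(n,q,\delta,1)}$ has parameters $[n,k,d\ge\delta]$ and $\mathcal{C}_{(n,q,\delta+1,0)}$ has parameters $[n,k-1,d\ge2\delta]$, where $k$ is as follows. (1) If $2\le\delta\le\frac{q^{t+1}+1}{\lambda}+\frac{2(q^t-1)}{\lambda}$, let $\upsilon=\lfloor\frac{q-2}{\lambda}\rfloor+\lfloor\frac{q}{\lambda}\rfloor$. Then $k=n-2m\epsilon$ if $2\le\delta\le\frac{q^{t+1}+1}{\lambda}-\lfloor\frac q\lambda\rfloor$; $k=n-2m\epsilon+2m\big(\delta-\frac{q^{t+1}+1}{\lambda}+\lfloor\frac q\lambda\rfloor\big)$ if $\frac{q^{t+1}+1}{\lambda}-\lfloor\frac q\lambda\rfloor<\delta\le\frac{q^{t+1}+1}{\lambda}+\lfloor\frac{q-2}{\lambda}\rfloor$; and $k=n-2m(\epsilon-\upsilon-1)$ if $\frac{q^{t+1}+1}{\lambda}+\lfloor\frac{q-2}{\lambda}\rfloor<\delta\le\frac{q^{t+1}+1}{\lambda}+\frac{2(q^t-1)}{\lambda}$. (2) If $\lfloor\frac{q-3}{\lambda}\rfloor\ne0$ and $\frac{q^{t+1}+1}{\lambda}+\frac{2(q^t-1)}{\lambda}<\delta\le\frac{q^{t+1}+1}{\lambda}+\frac{2(q^t-1)}{\lambda}+\lfloor\frac{q-3}{\lambda}\rfloor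 q^t$, then for an integer $a\in[0,\lfloor\frac{q-3}{\lambda}\rfloor-1]$: $k=n-2m(\epsilon-\upsilon-2a-2)$ if $\frac{q^{t+1}+1}{\lambda}+\frac{2(q^t-1)}{\lambda}+aq^t<\delta\le\frac{q^{t+1}+1}{\lambda}+(a+1)q^t$; and $k=n-2m(\epsilon-\upsilon-2a-3)$ if $\frac{q^{t+1}+1}{\lambda}+(a+1)q^t<\delta\le\frac{q^{t+1}+1}{\lambda}+\frac{2(q^t-1)}{\lambda}+(a+1)q^t$ (with $\upsilon$ as in (1)). (3) If $\frac{q^{t+1}+1}{\lambda}+\frac{2(q^t-1)}{\lambda}+\lfloor\frac{q-3}{\lambda}\rfloor q^t<\delta\le\frac{2q^{t+1}+2q-1}{\lambda}+1$, let $\kappa=2\frac{q^{t+1}+1}{\lambda}-\lfloor\frac{2q+1}{\lambda}\rfloor$ and $\tau=\lceil(\kappa-1)(1-q^{-1})\rceil$ (and $\upsilon$ as in (1)). (i) If $\lfloor\frac{q-1}{\lambda}\rfloor=\lfloor\frac{q-3}{\lambda}\rfloor$, then $k=n-2m(\epsilon-\upsilon-2\lfloor\frac{q-1}{\lambda}\rfloor-2)$ if $\frac{q^{t+1}+1}{\lambda}+\frac{2(q^t-1)}{\lambda}+\lfloor\frac{q-3}{\lambda}\rfloor q^t<\delta\le\kappa$, and $k=n-2m(\tau-\upsilon-2\lfloor\frac{q-1}{\lambda}\rfloor-2)$ if $\kappa<\delta\le\frac{2q^{t+1}+2q-1}{\lambda}+1$. (ii) If $\lfloor\frac{q-1}{\lambda}\rfloor=\lfloor\frac{q-3}{\lambda}\rfloor+1$,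 then $k=n-2m(\epsilon-\upsilon-2\lfloor\frac{q-1}{\lambda}\rfloor)$ if $\frac{q^{t+1}+1}{\lambda}+\frac{2(q^t-1)}{\lambda}+\lfloor\frac{q-3}{\lambda}\rfloor q^t<\delta\le\frac{q^{t+1}+1}{\lambda}+\lfloor\frac{q-1}{\lambda}\rfloor q^t$; $k=n-2m(\epsilon-\upsilon-2\lfloor\frac{q-1}{\lambda}\rfloor-1)$ if $\frac{q^{t+1}+1}{\lambda}+\lfloor\frac{q-1}{\lambda}\rfloor q^t<\delta\le\kappa$; and $k=n-2m(\tau-\upsilon-2\lfloor\frac{q-1}{\lambda}\rfloor-1)$ if $\kappa<\delta\le\frac{2q^{t+1}+2q-1}{\lambda}+1$.
   Context: Let $q$ be a prime power and $n\ge2$ an integer with $\gcd(n,q)=1$. Let $\ell=\mathrm{ord}_n(q)$, let $\alpha$ be a generator of $\mathbb{F}_{q^\ell}^*$, $\beta=\alpha^{(q^\ell-1)/n}$, and let $m_i(x)$ be the minimal polynomial of $\beta^i$ over $\mathbb{F}_q$. For integers $b\ge0$ and $2\le\delta\le n$, $\mathcal{C}_{(n,q,\delta,b)}$ denotes the cyclic (BCH) code of length $n$ over $\mathbb{F}_q$ with generator polynomial $\mathrm{lcm}(m_b(x),\dots,m_{b+\delta-2}(x))$. A linear code $\mathcal{C}$ is LCD if $\mathcal{C}\cap\mathcal{C}^\perp=\{0\}$ (Euclidean dual). $[n,k,d\ge D]$ means length $n$, dimension $k$, minimum Hamming distance at least $D$. *)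

(* Defs.v *)
From HB Require Import structures.
From mathcomp Require Import all_boot all_order all_algebra all_field.
Set Implicit Arguments. Unset Strict Implicit. Unset Printing Implicit Defensive.
Import Order.TTheory GRing.Theory Num.Theory.
Local Open Scope ring_scope.

Definition is_ord_mod (n q l : nat) : Prop :=
  (0 < l)%N /\ (q ^ l = 1 %[mod n])%N /\
  (forall j : nat, (0 < j < l)%N -> (q ^ j != 1 %[mod n])%N).

(* lcm of two polynomials over a field (defined up to a nonzero constant,
   which is irrelevant for the generated code) *)
Definition lcmp (L : fieldType) (p r : {poly L}) : {poly L} := (p * r) %/ gcdp p r.

Definition bch_gen (F : fieldType) (L : fieldExtType F) (beta : L) (delta b : nat)
  : {poly L} :=
  \big[@lcmp L/1]_(b <= i < b + delta - 1) minPoly 1%VS (beta ^+ i).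

Definition bch_code (F : finFieldType) (L : fieldExtType F) (n : nat) (beta : L)
  (delta b : nat) : {set 'rV[F]_n} :=
  [set c : 'rV[F]_n | bch_gen beta delta b %| map_poly (in_alg L) (rVpoly c)].

Definition code_dim (F : finFieldType) (n : nat) (C : {set 'rV[F]_n}) : nat :=
  \dim (<< enum C >>%VS).

Definition hweight (F : finFieldType) (n : nat) (c : 'rV[F]_n) : nat :=
  #|[set i : 'I_n | c 0 i != 0]|.

Definition min_dist_ge (F : finFieldType) (n : nat) (C : {set 'rV[F]_n}) (D : nat)
  : Prop := forall c, c \in C -> c != 0 -> (D <= hweight c)%N.

Definition dual_code (F : finFieldType) (n : nat) (C : {set 'rV[F]_n}) : {set 'rV[F]_n} :=
  [set v : 'rV[F]_n | [forall c in C, (v *m c^T) 0 0 == 0]].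

Definition is_LCD (F : finFieldType) (n : nat) (C : {set 'rV[F]_n}) : Prop :=
  C :&: dual_code C = [set 0].

Definition ceil_div (a b : nat) : nat := ((a + b - 1) %/ b)%N.

(* Main.v *)
Require Import Defs.
From HB Require Import structures.
From mathcomp Require Import all_boot all_order all_algebra all_field.
From mathcomp Require Import zify.
Set Implicit Arguments. Unset Strict Implicit. Unset Printing Implicit Defensive.
Import Order.TTheory GRing.Theory Num.Theory.

(** The discrete Fourier transform of a word at [i] is the value of its polynomial at
    [beta ^ i], so a BCH code is the set of words whose transform vanishes on a set Z of
    residues mod n that is closed under multiplication by q.  The generator polynomial
    of Z is fixed by Frobenius, whence the dimension n - #Z; since q^m = -1 mod n, Z is
    also closed under negation, which gives the LCD property and, together with the
    root 1, the 2 delta - 1 consecutive zeros [-(delta - 1) .. delta - 1].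

    To count Z, scale by lambda: x and y lie in one coset iff, up to order,
    [V q^j = +- U] modulo N = q^m + 1 with U = lambda x, V = lambda y and j <= t.  As
    U, V are at most 2 q^(t+1) + 2 q - 1, this forces U = V q^j, or j = t and
    [V q^t +- U] in {N, 2N}, i.e. with Q = q^t
      U = 1 + u Q, V = q Q - u;      U = u Q - 1, V = q Q + u;
      U = 2 + u Q, V = 2 q Q - u;    U = u Q - 2, V = 2 q Q + u,
    for some u <= 2 q.  Every coset of a leader has size exactly 2 m, and the non-leaders
    are the multiples of q and the larger members of these pairs. *)

(** * Cyclotomic cosets modulo (q^m + 1) / lambda *)

Lemma coprime_eqmod_mul2l (n u a b : nat) :
  coprime u n -> (u * a == u * b %[mod n]) = (a == b %[mod n]).
Proof.
move=> cun; wlog ab : a b / (b <= a)%N => [H|].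
  by case: (leqP b a) => [|/ltnW] /H // E; rewrite eq_sym E eq_sym.
by rewrite !eqn_mod_dvd ?leq_mul2l ?ab ?orbT // -mulnBr Gauss_dvdr // coprime_sym.
Qed.

(** * Small solutions of [V * q ^ j = +- U] modulo [q ^ m + 1] *)

Section Key.
Variables (q Q N : nat).
Hypotheses (q3 : 3 <= q) (qQ : q ^ 2 <= Q) (NE : N = q * Q ^ 2 + 1).
Local Notation T := (2 * (q * Q) + 2 * q - 1).

Let Qq : 3 * q <= Q.
Proof. by apply: leq_trans qQ; rewrite -mulnn leq_mul2r q3 orbT. Qed.

Let QQ : 3 * (q * Q) <= Q ^ 2.
Proof. by rewrite mulnA -mulnn leq_mul2r Qq orbT. Qed.

(** For [W = q ^ j] with [j < t], the product [V * W] is at most [2 * Q ^ 2 + 2 * Q], while [N]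
    exceeds [3 * Q ^ 2]; the spare [Q ^ 2] is at least [3 * (q * Q)] and absorbs the rest.
    Congruences modulo [N] thus become equalities. *)
Lemma small_bound U V W : q * W <= Q -> U <= T -> V <= T -> V * W + U < N.
Proof.
move=> qW UT VT; have W1 : 3 * W <= Q by apply: leq_trans qW; rewrite leq_mul2r q3 orbT.
have : V * W <= 2 * Q ^ 2 + 2 * Q.
  apply: leq_trans (_ : (2 * (q * Q) + 2 * q) * W <= _).
    by rewrite leq_mul2r; apply/orP; right; lia.
  apply: leq_trans (_ : 2 * (q * W) * Q + 2 * (q * W) <= _); first by nia.
  by nia.
have : 3 * Q ^ 2 <= q * Q ^ 2 by rewrite leq_mul2r q3 orbT.
have : 3 * Q <= q * Q by rewrite leq_mul2r q3 orbT.
lia.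
Qed.

Lemma key_small_add U V W :
  q * W <= Q -> 0 < U <= T -> V <= T -> ~~ (N %| V * W + U).
Proof.
move=> qW UT VT; apply/negP => /dvdn_leq H.
by have := @small_bound U V W qW; lia.
Qed.

Lemma key_small_eq U V W :
  q * W <= Q -> 0 < U <= T -> V <= T -> V * W = U %[mod N] -> V * W = U.
Proof.
move=> qW UT VT; have := @small_bound U V W qW _ VT.
by move=> H; rewrite !modn_small //; lia.
Qed.

(** The sum stays below [3 * N], so it is [c * N] with [c] equal to 1 or 2. Since
    [c * N = c * (q * Q) * Q + c], putting [u = c * (q * Q) - V] leaves [U = c + u * Q]. *)
Lemma key_big_add U V : 0 < U <= T -> V <= T -> N %| V * Q + U ->
  exists2 u, u <= 2 * q &
    (U = 1 + u * Q /\ V + u = q * Q) \/ (U = 2 + u * Q /\ V + u = 2 * (q * Q)).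
Proof.
move=> UT VT /dvdnP [c E].
have c3 : c < 3.
  rewrite -(@ltn_pmul2r N) -?E; last by lia.
  have : V * Q <= T * Q by rewrite leq_mul2r VT orbT.
  by nia.
have c0 : 0 < c by case: c E {c3} => [|//]; lia.
have cE : V * Q + U = c * (q * Q) * Q + c by rewrite E NE; nia.
(* A larger [V] would already give [V * Q > c * N], because [c < Q]. *)
have Vc : V <= c * (q * Q).
  rewrite leqNgt; apply/negP => H.
  have : (c * (q * Q)).+1 * Q <= V * Q by rewrite leq_mul2r H orbT.
  by rewrite mulSn; lia.
have UE : U = c + (c * (q * Q) - V) * Q.
  by rewrite mulnBl; have := leq_mul Vc (leqnn Q); lia.
exists (c * (q * Q) - V); first by nia.
case: c c3 c0 E cE Vc UE => [|[|[|//]]] _ // _ _ _ Vc UE; [left|right]; lia.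
Qed.

(** The same comparison with [u = V - c * (q * Q)], where [c] is the quotient of [V * Q] by [N];
    [c = 0] gives the trivial solution. *)
Lemma key_big_eq U V : 0 < U <= T -> V <= T -> V * Q = U %[mod N] ->
  V * Q = U \/
  exists2 u, 0 < u <= 2 * q &
    (U + 1 = u * Q /\ V = q * Q + u) \/ (U + 2 = u * Q /\ V = 2 * (q * Q) + u).
Proof.
move=> UT VT; have UN : U < N by nia.
rewrite (modn_small UN) => E; have := divn_eq (V * Q) N; rewrite E.
set c := _ %/ _ => {}E.
have c3 : c < 3.
  rewrite -(@ltn_pmul2r N); last by lia.
  have : V * Q <= T * Q by rewrite leq_mul2r VT orbT.
  by nia.
case: (posnP c) => [c0|c0]; first by left; rewrite E c0.
right.
have cE : V * Q = c * (q * Q) * Q + c + U by rewrite E NE; nia.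
have Vc : c * (q * Q) < V.
  by rewrite -(@ltn_pmul2r Q); lia.
have UE : U + c = (V - c * (q * Q)) * Q.
  by rewrite mulnBl; lia.
exists (V - c * (q * Q)).
  rewrite subn_gt0 Vc /= -ltnS -(@ltn_pmul2r Q) -?UE ?mulSn; lia.
case: c c3 c0 E cE Vc UE => [|[|[|//]]] _ // _ _ _ Vc UE; [left|right]; lia.
Qed.

End Key.

(* The larger members of the four families of pairs: the first block comes from
   [q Q -+ u] with u < q, the two progressions from [1 + u Q] and [u Q - 1] with
   q < u < 2 q, and the final segment from the pairs around 2 q Q. *)
Definition exceptional (q lam Q x : nat) : bool :=
  let A := (q * Q + 1) %/ lam in let B := (2 * (Q - 1)) %/ lam in
  [|| A - q %/ lam <= x <= A + (q - 2) %/ lam,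
      has (fun i => x == A + i * Q) (iota 1 ((q - 1) %/ lam)),
      has (fun i => x == A + B + i * Q) (iota 0 ((q - 3) %/ lam).+1)
    | 2 * A - (2 * q + 1) %/ lam <= x].

(** As long as [x * lam] is at most [T], these are the least positive members of their cosets. *)
Definition leader (q lam Q x : nat) : bool := ~~ (q %| x) && ~~ exceptional q lam Q x.

(** For [Q = q ^ t] this puts [x] and [y] in one coset, as -1 is a power of [q]. The relation is not
    symmetric in form, so both orders occur below. *)
Definition linked (n Q x y : nat) : Prop := n %| x * Q + y \/ x * Q = y %[mod n].

(** * Exceptional values and linked pairs *)

Section Leaders.
Variables (q lam Q N n A B : nat).
Hypotheses (q3 : 3 <= q) (qQ : q ^ 2 <= Q) (NE : N = q * Q ^ 2 + 1).
Hypotheses (q_dvdQ : q %| Q) (lam2 : 2 <= lam) (lam_q : lam %| q + 1)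
  (lam_Q : lam %| Q - 1) (nE : n * lam = N).
Hypotheses (AE : A * lam = q * Q + 1) (BE : B * lam = 2 * (Q - 1)).
Local Notation T := (2 * (q * Q) + 2 * q - 1).
Local Notation r1 := ((q - 1) %/ lam).
Local Notation r3 := ((q - 3) %/ lam).

Let lam0 : 0 < lam. Proof. exact: ltnW. Qed.
Let Q9 : 9 <= Q. Proof. by apply: leq_trans qQ; rewrite -mulnn (leq_mul q3 q3). Qed.

Let col_q : coprime lam q.
Proof.
rewrite /coprime -dvdn1 -(@dvdn_addr q) ?dvdn_gcdr //.
by apply: dvdn_trans (dvdn_gcdl _ _) lam_q.
Qed.

Let col_Q : coprime lam Q.
Proof.
have QE : Q = (Q - 1) + 1 by lia.
rewrite /coprime -dvdn1 -(@dvdn_addr (Q - 1)).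
  by rewrite -QE dvdn_gcdr.
by apply: dvdn_trans (dvdn_gcdl _ _) lam_Q.
Qed.

Lemma exceptionalE x : exceptional q lam Q x =
  [|| A - q %/ lam <= x <= A + (q - 2) %/ lam,
      has (fun i => x == A + i * Q) (iota 1 r1),
      has (fun i => x == A + B + i * Q) (iota 0 r3.+1)
    | 2 * A - (2 * q + 1) %/ lam <= x].
Proof. by rewrite /exceptional -AE -BE !mulnK. Qed.

(** The two signs give [(A - x) * lam = u + 1 <= q] and [(x - A) * lam = u - 1 <= q - 2], whence the
    two ends of the block around [A]. *)
Lemma exceptional_mid x u : u < q -> x * lam + u = q * Q \/ (x * lam = q * Q + u /\ 0 < u) ->
  exceptional q lam Q x.
Proof.
move=> uq H; rewrite exceptionalE; apply/orP; left; apply/andP.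
split.
  rewrite leq_subLR; case: H => H; last first.
    by apply: leq_trans (leq_addl _ _); rewrite -(leq_pmul2r lam0) AE; lia.
  have : A - x <= q %/ lam; last by lia.
  by rewrite leq_divRL // mulnBl AE; lia.
case: H => H.
  by apply: leq_trans (leq_addr _ _); rewrite -(leq_pmul2r lam0) AE; lia.
have : x - A <= (q - 2) %/ lam; last by lia.
by rewrite leq_divRL // mulnBl AE; lia.
Qed.

Lemma exceptional_top x : 2 * (q * Q) < x * lam + 2 * q -> exceptional q lam Q x.
Proof.
move=> H; rewrite exceptionalE; apply/orP; right; apply/orP; right; apply/orP; right.
have : 2 * A - x <= (2 * q + 1) %/ lam; last by lia.
by rewrite leq_divRL // mulnBl -mulnA AE; lia.
Qed.

(** Here [(y - A) * lam = (u - q) * Q] with [lam] coprime to [Q], so [y - A] is a multiple of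
    [Q]. *)
Lemma exceptional_plus y u : q <= u <= 2 * q -> y * lam = 1 + u * Q ->
  exceptional q lam Q y.
Proof.
move=> uq yE.
have yA : A <= y.
  rewrite -(leq_pmul2r lam0) AE yE; have := leq_mul (proj1 (andP uq)) (leqnn Q); lia.
have E : (y - A) * lam = (u - q) * Q by rewrite !mulnBl AE yE; lia.
have : lam %| u - q by rewrite -(Gauss_dvdl _ col_Q) -E dvdn_mull.
move/dvdnP => [i iE].
have {}E : y = A + i * Q.
  suff : y - A = i * Q by lia.
  by apply/eqP; rewrite -(eqn_pmul2r lam0) E iE mulnAC.
have [i0|i0] := posnP i.
  have := @exceptional_mid A 1; rewrite AE E i0 addn0; apply; first by lia.
  by right.
(* The value [u = 2 * q] is excluded: [lam] would divide both [q] and [q + 1]. *)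
have iq : i * lam <= q - 1.
  have : u <> 2 * q; last by lia.
  move=> uE; have : lam %| 1; last by rewrite dvdn1; lia.
  rewrite -(@dvdn_addr q) //.
  have -> : q = u - q by lia.
  by rewrite iE dvdn_mull.
rewrite exceptionalE; apply/orP; right; apply/orP; left; apply/hasP; exists i.
  by rewrite mem_iota i0 /= add1n ltnS leq_divRL.
by rewrite E.
Qed.

(** The progression starts at [u = q + 2], which is [y = A + B]. *)
Lemma exceptional_minus y u : q < u <= 2 * q -> y * lam + 1 = u * Q ->
  exceptional q lam Q y.
Proof.
move=> uq yE.
have ABE : (A + B) * lam = q * Q + 2 * Q - 1 by rewrite mulnDl AE BE; lia.
(* For [u = q + 1] the difference from [A + B] would make [lam] divide [Q]. *)
have [u1|u1] : u = q + 1 \/ q + 2 <= u by lia.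
  exfalso; have : lam %| Q.
    have -> : Q = (A + B - y) * lam by move: yE; rewrite mulnBl ABE u1 mulnDl; lia.
    by rewrite dvdn_mull.
  by move/gcdn_idPl => E; move: col_Q; rewrite /coprime E => /eqP; lia.
have E : (y - (A + B)) * lam = (u - (q + 2)) * Q.
  by rewrite !mulnBl ABE; lia.
have yA : A + B <= y.
  by rewrite -(leq_pmul2r lam0) ABE; have := leq_mul u1 (leqnn Q); lia.
have : lam %| u - (q + 2) by rewrite -(Gauss_dvdl _ col_Q) -E dvdn_mull.
move/dvdnP => [i iE].
have {}E : y = A + B + i * Q.
  suff : y - (A + B) = i * Q by lia.
  by apply/eqP; rewrite -(eqn_pmul2r lam0) E iE mulnAC.
(* For [u = 2 * q], [y * lam = 2 * (q * Q) - 1] lies in the final segment. *)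
have [u2|u2] : u = 2 * q \/ u <= 2 * q - 1 by lia.
  by apply: exceptional_top; move: yE; rewrite u2; lia.
have iq : i * lam <= q - 3 by lia.
rewrite exceptionalE; do 2 (apply/orP; right); apply/orP; left; apply/hasP; exists i.
  by rewrite mem_iota /= add0n ltnS leq_divRL.
by rewrite E.
Qed.

(** The larger member of each pair is exceptional: [x] when [u < q] in the first family or
    [u < 2 * q] in the second, and [y] otherwise. *)
Lemma leader_add x y : leader q lam Q x -> leader q lam Q y ->
  0 < y * lam <= T -> x * lam <= T -> ~~ (n %| x * Q + y).
Proof.
move=> /andP [xq xE] /andP [yq yE] yT xT; apply/negP => nxy.
have : N %| x * lam * Q + y * lam.
  by rewrite mulnAC -mulnDl -nE dvdn_pmul2r.
case/(key_big_add q3 qQ NE yT xT) => u u2 [] [EU EV].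
  have [uq|uq] := ltnP u q.
    by move/negP: xE; apply; apply: (exceptional_mid uq); left.
  by move/negP: yE; apply; apply: (@exceptional_plus _ u); rewrite ?uq.
have [uq|uq] : u < 2 * q \/ u = 2 * q.
  by move: u2; rewrite leq_eqVlt => /orP [/eqP ->|->]; [right|left].
  by move/negP: xE; apply; apply: exceptional_top; clear - EV uq; lia.
by move/negP: yE; apply; apply: exceptional_top; rewrite EU uq -mulnA; clear; lia.
Qed.

Lemma leader_eq x y : leader q lam Q x -> leader q lam Q y ->
  0 < y * lam <= T -> x * lam <= T -> x * Q <> y %[mod n].
Proof.
move=> /andP [xq xE] /andP [yq yE] yT xT nxy.
have : x * lam * Q = y * lam %[mod N].
  by rewrite mulnAC -nE -!muln_modl nxy.
case/(key_big_eq q3 qQ NE yT xT) => [|[u u2 [] [EU EV]]].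
- rewrite mulnAC => /eqP; rewrite eqn_pmul2r // => /eqP E.
  by move/negP: yq; apply; rewrite -E dvdn_mull.
- have [uq|uq] := ltnP u q.
    by move/negP: xE; apply; apply: (exceptional_mid uq); right; clear - EV u2; lia.
  (* At [u = q], [x * lam = q * Q + q] makes [x] a multiple of [q]. *)
  have [uq'|uq'] : u = q \/ q < u by clear - uq; lia.
    move/negP: xq; apply; rewrite -(Gauss_dvdl x (p := lam)) 1?coprime_sym //.
    by rewrite EV uq' dvdn_add ?dvdn_mulr.
  by move/negP: yE; apply; apply: (@exceptional_minus _ u); rewrite ?uq' //; clear - u2; lia.
- by move/negP: xE; apply; apply: exceptional_top; clear - EV u2; lia.
Qed.

Lemma leader_small_add x y W : q * W <= Q -> 0 < y * lam <= T -> x * lam <= T ->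
  ~~ (n %| x * W + y).
Proof.
move=> qW yT xT; rewrite -(dvdn_pmul2r lam0) nE mulnDl mulnAC.
exact: (key_small_add q3 qQ NE).
Qed.

Lemma leader_small_eq x y W : q * W <= Q -> 0 < y * lam <= T -> x * lam <= T ->
  x * W = y %[mod n] -> x * W = y.
Proof.
move=> qW yT xT nxy; have : x * lam * W = y * lam %[mod N].
  by rewrite mulnAC -nE -!muln_modl nxy.
move/(key_small_eq q3 qQ NE qW yT xT); rewrite mulnAC => /eqP.
by rewrite eqn_pmul2r // => /eqP.
Qed.

Let lamN : lam %| N. Proof. by rewrite -nE dvdn_mull. Qed.

(** A partner [U] found at scale [lam] descends to an integer [y], since [lam] divides [N] and
    [x * lam], hence [U]. *)
Lemma linkedr x U c : x * lam * Q + U = c * N \/ x * lam * Q = c * N + U ->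
  0 < U < x * lam -> exists2 y, 0 < y < x & linked n Q x y.
Proof.
move=> H UV; have lx : lam %| x * lam * Q by rewrite dvdn_mulr // dvdn_mull.
have lU : lam %| U.
  have lN : lam %| c * N by rewrite dvdn_mull.
  case: H => E; first by rewrite -(dvdn_addr _ lx) E.
  by rewrite -(dvdn_addr _ lN) -E.
move: lU UV H => /dvdnP [y ->].
rewrite muln_gt0 ltn_pmul2r // => /andP [/andP [y0 _] yx] H.
exists y; first by rewrite y0.
rewrite -nE mulnA in H; case: H => /eqP.
  rewrite mulnAC -mulnDl eqn_pmul2r // => /eqP H.
  by left; rewrite H dvdn_mull.
rewrite mulnAC -mulnDl eqn_pmul2r // => /eqP H.
by right; rewrite H modnMDl.
Qed.

Lemma linkedl x V c : V * Q + x * lam = c * N \/ V * Q = c * N + x * lam ->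
  0 < V < x * lam -> exists2 y, 0 < y < x & linked n Q y x.
Proof.
move=> H UV; have lx : lam %| x * lam by rewrite dvdn_mull.
have lN : lam %| c * N by rewrite dvdn_mull.
have lV : lam %| V.
  rewrite -(Gauss_dvdl _ col_Q).
  case: H => E; first by rewrite -(dvdn_addl _ lx) E.
  by rewrite E dvdn_add.
move: lV UV H => /dvdnP [y ->].
rewrite muln_gt0 ltn_pmul2r // => /andP [/andP [y0 _] yx] H.
exists y; first by rewrite y0.
rewrite -nE mulnA in H; case: H => /eqP.
  rewrite mulnAC -mulnDl eqn_pmul2r // => /eqP H.
  by left; rewrite H dvdn_mull.
rewrite mulnAC -mulnDl eqn_pmul2r // => /eqP H.
by right; rewrite H modnMDl.
Qed.

Let Qq : 3 * q <= Q.
Proof. by apply: leq_trans qQ; rewrite -mulnn leq_mul2r q3 orbT. Qed.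

Lemma leq_mulQ u v : u <= v -> u * Q <= v * Q.
Proof. by move=> uv; rewrite leq_mul2r uv orbT. Qed.

(** Converse of the two exclusions for leaders: each clause of [exceptional] yields an explicit
    smaller partner. In the block and the final segment [x * lam] plays the role of [V]; in the
    progressions it plays that of [U]. *)
Lemma exceptional_linked x : ~~ (q %| x) -> x * lam <= T -> exceptional q lam Q x ->
  exists2 y, 0 < y < x & linked n Q x y \/ linked n Q y x.
Proof.
move=> xq xT.
have NE' : N = q * Q * Q + 1 by rewrite NE -mulnn mulnA.
(* Both signs at once for [x * lam] in the role of [V]: [c = 1] serves the block and [c = 2] the
   final segment. *)
have L u c U : x * lam + u = c * (q * Q) /\ U = c + u * Q \/
    x * lam = c * (q * Q) + u /\ U + c = u * Q ->
    0 < U < x * lam -> exists2 y, 0 < y < x & linked n Q x y \/ linked n Q y x.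
  move=> H UV; have [|y yx ly] := @linkedr x U c _ UV; last by exists y => //; left.
  have -> : c * N = c * (q * Q) * Q + c by rewrite NE' mulnDr muln1 mulnA.
  case: H => -[E1 E2]; [left; rewrite E2 | right; rewrite E1].
    have := congr1 (muln^~ Q) E1; rewrite mulnDl; clear; lia.
  rewrite mulnDl -E2; clear; lia.
have qQ0 : 2 * Q < q * Q by rewrite ltn_pmul2r; lia.
rewrite exceptionalE => /or4P [].
- move=> /andP [H1 H2].
  have [xA|xA] := ltnP x A.
    have : (A - x) * lam <= q.
      by rewrite -(leq_divRL _ _ lam0) leq_subLR addnC -leq_subLR.
    rewrite mulnBl AE => H.
    have xlA : x * lam < A * lam by rewrite ltn_pmul2r.
    rewrite AE in xlA.
    have [u uE] : exists u, x * lam + u = q * Q.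
      by exists (q * Q - x * lam); apply: subnKC; clear - xlA; lia.
    have uq : u <= q - 1 by clear - H xlA uE; lia.
    have := leq_mulQ uq; rewrite (mulnBl q) => H3.
    apply: (L u 1 (1 + u * Q)).
      by left; clear - uE; lia.
    by clear - uq uE H3 q3 Qq qQ0; lia.
  have : (x - A) * lam <= q - 2.
    by rewrite -(leq_divRL _ _ lam0) leq_subLR.
  rewrite mulnBl AE => H.
  have xlA : A * lam <= x * lam by rewrite leq_pmul2r.
  rewrite AE in xlA.
  have [u uE] : exists u, x * lam = q * Q + u.
    by exists (x * lam - q * Q); rewrite subnKC //; clear - xlA; lia.
  have uq : u <= q - 1 by clear - H q3 uE; lia.
  have u1 : 1 <= u by clear - xlA uE; lia.
  have := leq_mulQ uq; have := leq_mulQ u1; rewrite (mulnBl q) => H3 H4.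
  apply: (L u 1 (u * Q - 1)).
    by right; clear - uE H3 Q9; lia.
  by clear - uq uE H3 H4 q3 Qq qQ0; lia.
- move=> /hasP [i]; rewrite mem_iota => /andP [i0 i1] /eqP xE.
  have iq : i * lam <= q - 1 by rewrite -(leq_divRL _ _ lam0) -ltnS.
  have il : 0 < i * lam by rewrite muln_gt0 i0.
  have xlE : x * lam = 1 + (q * Q + i * lam * Q) by rewrite xE mulnDl AE mulnAC; clear; lia.
  have H := leq_mulQ il.
  have vq : q + i * lam <= q * Q.
    by clear - iq qQ0 Qq q3; lia.
  have H' := leq_mulQ vq.
  (* The partner of [1 + u * Q] is [q * Q - u], with [u = q + i * lam]. *)
  have [||y yx ly] := @linkedl x (q * Q - (q + i * lam)) 1.
  - left; move: H'; rewrite NE' xlE mulnBl mulnDl; clear; lia.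
  - by clear - xlE vq iq qQ0 Qq q3 H; lia.
  by exists y => //; right.
- move=> /hasP [i]; rewrite mem_iota => /andP [_ i1] /eqP xE.
  have iq : i * lam <= q - 3 by rewrite -(leq_divRL _ _ lam0) -ltnS.
  have xlE : x * lam + 1 = q * Q + 2 * Q + i * lam * Q.
    by rewrite xE !mulnDl AE BE mulnAC; clear - Q9; lia.
  (* The partner of [u * Q - 1] is [q * Q + u], with [u = q + 2 + i * lam]. *)
  have [||y yx ly] := @linkedl x (q * Q + (q + 2 + i * lam)) 1.
  - by right; rewrite NE' !mulnDl; clear - xlE Q9; lia.
  - by clear - xlE iq qQ0 Qq q3; lia.
  by exists y => //; right.
- move=> H1.
  have A2 : 2 * A * lam = 2 * (q * Q) + 2 by rewrite -mulnA AE; clear; lia.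
  have [xA|xA] := ltnP (x * lam) (2 * (q * Q)).
    have : (2 * A - x) * lam <= 2 * q + 1.
      by rewrite -(leq_divRL _ _ lam0) leq_subLR addnC -leq_subLR.
    rewrite mulnBl A2 => H.
    have [u uE] : exists u, x * lam + u = 2 * (q * Q).
      by exists (2 * (q * Q) - x * lam); apply: subnKC; clear - xA; lia.
    have uq : u <= 2 * q - 1 by clear - H uE; lia.
    have := leq_mulQ uq; rewrite (mulnBl (2 * q)) => H3.
    apply: (L u 2 (2 + u * Q)).
      by left; clear - uE; lia.
    by clear - uq uE H3 q3 Qq qQ0; lia.
  (* This value lies in the final segment but would make [x] a multiple of [q]. *)
  have xN : x * lam <> 2 * (q * Q).
    move=> E; move/negP: xq; apply; rewrite -(Gauss_dvdl x (p := lam)) 1?coprime_sym //.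
    by rewrite E dvdn_mull ?dvdn_mulr.
  have [u uE] : exists u, x * lam = 2 * (q * Q) + u.
    by exists (x * lam - 2 * (q * Q)); rewrite subnKC //; clear - xA; lia.
  have uq : u <= 2 * q - 1 by clear - xT q3 uE; lia.
  have u1 : 1 <= u by clear - xN uE; lia.
  have := leq_mulQ uq; have := leq_mulQ u1; rewrite (mulnBl (2 * q)) => H3 H4.
  apply: (L u 2 (u * Q - 2)).
    by right; clear - uE H3 Q9; lia.
  by clear - uq uE H3 H4 q3 Qq qQ0; lia.
Qed.

End Leaders.

(** * Unions of the cosets of 1, ..., d *)

Definition cyclotomic_zeros (q m n d i : nat) : bool :=
  has (fun j => has (fun k => i == j * q ^ k %[mod n]) (iota 0 (2 * m))) (iota 1 d).

Section CyclotomicZeros.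
Variables (q m n d : nat).
Hypotheses (m0 : 0 < m) (nqm : n %| q ^ m + 1).
Local Notation Z := (cyclotomic_zeros q m n d).

Lemma coprime_dvd_expS : coprime q n.
Proof.
rewrite coprime_sym /coprime -dvdn1 -(@dvdn_addr (q ^ m)).
  by apply: dvdn_trans (dvdn_gcdl _ _) nqm.
by rewrite dvdn_exp // dvdn_gcdr.
Qed.

Lemma eqmod_opp a b : n %| a + b -> b = a * q ^ m %[mod n].
Proof.
move=> nab; apply/eqP; rewrite -(eqn_modDl a); move: nab; rewrite /dvdn => /eqP ->.
by rewrite eq_sym -/(n %| _) -{1}[a]muln1 -mulnDr addnC dvdn_mull.
Qed.

Lemma expq2m a : a * q ^ (2 * m) = a %[mod n].
Proof.
rewrite mul2n -addnn expnD mulnA; apply/esym/eqmod_opp.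
by rewrite -{2}[a]muln1 -mulnDr dvdn_mull.
Qed.

Lemma expq_mod2m a k : a * q ^ (k %% (2 * m)) = a * q ^ k %[mod n].
Proof.
rewrite [in RHS](divn_eq k (2 * m)); elim: (k %/ _) => [|c IH] //.
by rewrite (mulSn c (2 * m)) -addnA addnC expnD mulnA expq2m IH.
Qed.

(** Since [q ^ (2 * m) = 1] modulo [n], the bounded range of exponents in the definition loses
    nothing. *)
Lemma cyclotomic_zerosP i :
  reflect (exists j k, 0 < j <= d /\ i = j * q ^ k %[mod n]) (Z i).
Proof.
apply: (iffP hasP) => [[j]|[j [k [jd E]]]].
  rewrite mem_iota add1n ltnS => jd /hasP [k _ /eqP E].
  by exists j, k.
exists j; first by rewrite mem_iota add1n ltnS.
apply/hasP; exists (k %% (2 * m)).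
  by rewrite mem_iota add0n ltn_mod muln_gt0.
by rewrite E expq_mod2m.
Qed.

Lemma cyclotomic_zeros_mod i : Z (i %% n) = Z i.
Proof. by rewrite /cyclotomic_zeros modn_mod. Qed.

Lemma cyclotomic_zeros_mulq i : Z (q * i) = Z i.
Proof.
apply/cyclotomic_zerosP/cyclotomic_zerosP => -[j [k [jd E]]]; exists j.
  (* The inverse of [q] modulo [n] is [q ^ (2 * m).-1]. *)
  exists (k + (2 * m).-1); split=> //.
  rewrite -(expq2m i) -[in LHS](ltn_predK (_ : 0 < 2 * m)) ?muln_gt0 //.
  by rewrite expnS mulnCA mulnA -modnMml E modnMml expnD mulnA.
by exists k.+1; split=> //; rewrite -modnMmr E modnMmr expnS mulnCA.
Qed.

Lemma cyclotomic_zeros_sym i j : n %| i + j -> Z i -> Z j.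
Proof.
move=> nij /cyclotomic_zerosP [x [k [xd E]]]; apply/cyclotomic_zerosP.
exists x, (k + m); split=> //.
by rewrite (eqmod_opp nij) -modnMml E modnMml expnD mulnA.
Qed.

Lemma cyclotomic_zeros0 : d < n -> ~~ Z 0.
Proof.
move=> dn; apply/cyclotomic_zerosP => -[j [k [/andP [j0 jd] E]]].
have : n %| j * q ^ k by rewrite /dvdn -E mod0n.
rewrite Gauss_dvdl; last by rewrite coprime_sym coprimeXl // coprime_dvd_expS.
by move/(dvdn_leq j0); rewrite leqNgt (leq_ltn_trans jd dn).
Qed.

End CyclotomicZeros.

(** * Cosets of leaders are disjoint and have [2 * m] elements *)

Section Cosets.
Variables (q lam t n A B : nat).
Local Notation Q := (q ^ t).
Local Notation m := (2 * t + 1).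
Local Notation T := (2 * (q * Q) + 2 * q - 1).
Hypotheses (q3 : 3 <= q) (t2 : 2 <= t) (lam2 : 2 <= lam) (lam_q : lam %| q + 1)
  (lam_Q : lam %| Q - 1) (nE : n * lam = q * Q ^ 2 + 1)
  (AE : A * lam = q * Q + 1) (BE : B * lam = 2 * (Q - 1)).
Local Notation lead := (leader q lam Q).

Let nqm : n %| q ^ m + 1.
Proof. by rewrite [2 * t + 1]addn1 expnS (mulnC 2) expnM -nE dvdn_mulr. Qed.

Let cqn : coprime q n := coprime_dvd_expS (ltn_addl _ (ltnSn 0)) nqm.

Let qQ : q ^ 2 <= Q.
Proof. by rewrite leq_exp2l //; apply: leq_trans q3. Qed.

Let q_dvdQ : q %| Q.
Proof. by apply: dvdn_exp => //; apply: leq_trans t2. Qed.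

Let qW j : j < t -> q * q ^ j <= Q.
Proof. by move=> jt; rewrite -expnS leq_exp2l //; apply: leq_trans q3. Qed.

Lemma leaders_half_add x y j : lead x -> lead y -> 0 < y * lam <= T -> x * lam <= T ->
  j <= t -> ~~ (n %| x * q ^ j + y).
Proof.
move=> lx ly yT xT; rewrite leq_eqVlt => /orP [/eqP ->|jt].
  exact: (leader_add q3 qQ (erefl _) q_dvdQ lam2 lam_q lam_Q nE AE BE).
exact: (leader_small_add q3 qQ (erefl _) lam2 nE (qW jt)).
Qed.

Lemma leaders_half_eq x y j : lead x -> lead y -> 0 < y * lam <= T -> x * lam <= T ->
  j <= t -> x * q ^ j = y %[mod n] -> j = 0 /\ x = y.
Proof.
move=> lx ly yT xT; rewrite leq_eqVlt => /orP [/eqP ->|jt] E.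
  by case: (leader_eq q3 qQ (erefl _) q_dvdQ lam2 lam_q lam_Q nE AE BE lx ly yT xT E).
have := leader_small_eq q3 qQ (erefl _) lam2 nE (qW jt) yT xT E.
case: j {jt E} => [|j]; first by rewrite muln1.
move=> E; case/andP: ly; rewrite -E.
by rewrite expnS mulnCA dvdn_mulr.
Qed.

(** For [t < j < m], multiplying by [q ^ (m - j)] turns the relation into [y * q ^ (m - j) = x],
    with exponent between 1 and [t]. *)
Lemma leaders_add x y j : lead x -> lead y -> 0 < y * lam <= T -> 0 < x * lam <= T ->
  j < m -> ~~ (n %| x * q ^ j + y).
Proof.
move=> lx ly yT xT jm; have [jt|jt] := leqP j t.
  by apply: leaders_half_add => //; case/andP: xT.
apply/negP => H; have : n %| y * q ^ m + y.
  by rewrite -{2}[y]muln1 -mulnDr dvdn_mull.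
have : n %| (x * q ^ j + y) * q ^ (m - j) by rewrite dvdn_mulr.
rewrite mulnDl -mulnA -expnD subnKC ?(ltnW jm) // => H1 H2.
have [||j0 _] := @leaders_half_eq y x (m - j) ly lx xT (proj2 (andP yT)).
- by clear - jt jm; lia.
- have H3 : n %| x * q ^ m + x by rewrite -{2}[x]muln1 -mulnDr dvdn_mull.
  apply/eqP; rewrite -(eqn_modDl (x * q ^ m)).
  by move: H1 H3; rewrite /dvdn => /eqP -> /eqP ->.
- by clear - j0 jm; lia.
Qed.

(** Beyond [t] the exponent is brought back by [q ^ m = -1]: the relation reads
    [x * q ^ (j - m) = - y] for [m <= j], and [y * q ^ (m - j) = - x] for [t < j < m]. The case
    [x = y] gives the size of a coset. *)
Lemma leaders_eq x y j : lead x -> lead y -> 0 < y * lam <= T -> 0 < x * lam <= T ->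
  j < 2 * m -> x * q ^ j = y %[mod n] -> j = 0 /\ x = y.
Proof.
move=> lx ly yT xT jm E; have [jt|jt] := leqP j t.
  by apply: leaders_half_eq => //; case/andP: xT.
exfalso; have [mj|mj] := leqP m j.
  have jm' : j - m < m by clear - mj jm; lia.
  move/negP: (leaders_add lx ly yT xT jm'); apply.
  have H3 : n %| (x * q ^ (j - m)) * q ^ m + x * q ^ (j - m).
    by rewrite -{2}[x * _]muln1 -mulnDr dvdn_mull.
  rewrite -mulnA -expnD subnK // in H3.
  by rewrite addnC /dvdn -modnDml -E modnDml.
have jm' : m - j < m by clear - mj jt; lia.
move/negP: (leaders_add ly lx xT yT jm'); apply.
have H3 : n %| x * q ^ m + x by rewrite -{2}[x]muln1 -mulnDr dvdn_mull.
move: H3; rewrite -{1}(subnKC (ltnW mj)) expnD mulnA.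
by rewrite /dvdn -modnDml -modnMml E modnMml modnDml.
Qed.

Variable d : nat.
Hypothesis dT : d * lam <= T.

Let bound x : 0 < x <= d -> 0 < x * lam <= T.
Proof.
move=> /andP [x0 xd]; rewrite muln_gt0 x0 (leq_trans _ lam2) //=.
by apply: leq_trans dT; rewrite leq_mul2r xd orbT.
Qed.

(** Descent: a non-leader is either a multiple of [q], replaced by [x %/ q], or exceptional,
    replaced by its smaller partner. *)
Lemma coset_leader x : 0 < x <= d ->
  exists y k, [/\ lead y, 0 < y <= x & x = y * q ^ k %[mod n]].
Proof.
elim/ltn_ind: x => x IH xd.
have step y k : 0 < y < x -> x = y * q ^ k %[mod n] ->
    exists y k, [/\ lead y, 0 < y <= x & x = y * q ^ k %[mod n]].
  move=> /andP [y0 yx] E; have [|z [k' [lz /andP [z0 zy] Ez]]] := IH y yx.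
    by rewrite y0 (leq_trans (ltnW yx)) //; case/andP: xd.
  exists z, (k' + k); rewrite z0 (leq_trans zy (ltnW yx)); split=> //.
  by rewrite E -modnMml Ez modnMml expnD mulnA.
have m0 : 0 < m by rewrite addn1.
case lx: (lead x); first by exists x, 0; rewrite muln1 leqnn andbT; split=> //; case/andP: xd.
case qx: (q %| x).
  have x0 : 0 < x by case/andP: xd.
  apply: (step (x %/ q) 1); last by rewrite expn1 divnK.
  rewrite divn_gt0 ?ltn_Pdiv //; last by apply: leq_trans q3.
    by rewrite dvdn_leq.
  by apply: leq_trans q3.
have ex : exceptional q lam Q x by move: lx; rewrite /leader qx /= => /negbFE.
have [||y yx] := exceptional_linked q3 qQ (erefl _) q_dvdQ lam2 lam_q lam_Q nE AE BE _ _ ex.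
- by rewrite qx.
- by case/andP: (bound xd).
have dbl z : n %| z * q ^ m + z by rewrite -{2}[z]muln1 -mulnDr dvdn_mull.
have mt : m = t + t.+1 by clear; lia.
(* As [t + t.+1 = m], [q ^ t.+1] inverts [Q] up to sign. The four forms of a link give
   [x = y * q ^ k] with [k] equal to [t.+1], [t.+1 + m], [t + m] and [t]. *)
case=> -[H|H].
- apply: (step y t.+1) => //; apply/eqP; rewrite -(eqn_modDl (x * q ^ m)).
  have : n %| (x * Q + y) * q ^ t.+1 by rewrite dvdn_mulr.
  rewrite mulnDl -mulnA -expnD -mt.
  by have := dbl x; rewrite /dvdn => /eqP -> /eqP ->.
- apply: (step y (t.+1 + m)) => //.
  rewrite expnD mulnA; apply: (eqmod_opp nqm).
  by rewrite addnC /dvdn -modnDmr -modnMml -H modnMml -mulnA -expnD -mt modnDmr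
    -/(n %| _) addnC.
- apply: (step y (t + m)) => //.
  by rewrite expnD mulnA; apply: (eqmod_opp nqm).
- by apply: (step y t).
Qed.

(** The residues are listed by pairs of a leader up to [d] and an exponent below [2 * m]:
    [coset_leader] shows that all are reached, [leaders_eq] that none repeats. *)
Lemma card_cyclotomic_zeros : #|[set r : 'I_n | cyclotomic_zeros q m n d r]| =
  2 * m * count lead (iota 1 d).
Proof.
have m0 : 0 < m by rewrite addn1.
have n0 : 0 < n by case: (n) nE => //; rewrite mul0n addn1.
pose s := [seq (j * q ^ k) %% n | j <- [seq j <- iota 1 d | lead j], k <- iota 0 (2 * m)].
have us : uniq s.
  apply: allpairs_uniq; [by rewrite filter_uniq ?iota_uniq | exact: iota_uniq|].
  move=> _ _ /allpairsP [[x k] /= [xl kl ->]] /allpairsP [[y k'] /= [yl kl' ->]].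
  move: xl yl kl kl'; rewrite !mem_filter !mem_iota !add1n !ltnS !add0n.
  move=> /andP [lx xd] /andP [ly yd] km km' /= E.
  (* With the exponents ordered, the invertible factor [q ^ k] can be cancelled. *)
  wlog kk : x y k k' lx xd ly yd km km' E / k <= k'.
    move=> H; have [|/ltnW k'k] := leqP k k'; first exact: H.
    by apply/esym/(H y x k' k).
  move/eqP: E; rewrite -(subnK kk) expnD mulnA ![_ * q ^ k]mulnC.
  rewrite coprime_eqmod_mul2l ?coprimeXl // eq_sym => /eqP E.
  have [|j0 yx] := leaders_eq ly lx (bound xd) (bound yd) _ E.
    by apply: leq_ltn_trans (leq_subr _ _) km'.
  by rewrite yx; congr (_, _); clear - j0 kk; lia.
have -> : #|[set r : 'I_n | cyclotomic_zeros q m n d r]| =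
    count (cyclotomic_zeros q m n d) (iota 0 n).
  rewrite -val_enum_ord count_map cardsE cardE enumT /enum_mem size_filter. by apply: eq_count.
have ss : size s = count lead (iota 1 d) * (2 * m).
  by rewrite size_allpairs size_filter size_iota.
rewrite [RHS]mulnC -ss -size_filter.
apply/perm_size/uniq_perm; rewrite ?filter_uniq ?iota_uniq // => i.
rewrite mem_filter mem_iota add0n /=; apply/andP/allpairsP => [[]|].
  move=> /(cyclotomic_zerosP _ m0 nqm) [x [k [xd E]]] i_n.
  have [y [k' [ly /andP [y0 yx] E']]] := coset_leader xd.
  exists (y, (k' + k) %% (2 * m)); split=> /=.
  - by rewrite mem_filter ly mem_iota add1n ltnS y0 (leq_trans yx) //; case/andP: xd.
  - by rewrite mem_iota add0n ltn_mod muln_gt0.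
  rewrite (expq_mod2m nqm) -(modn_small i_n) E.
  by rewrite -modnMml E' modnMml expnD mulnA.
case=> -[x k] /= [xl kl ->]; split; last by rewrite ltn_mod.
rewrite cyclotomic_zeros_mod; apply/(cyclotomic_zerosP _ m0 nqm); exists x, k; split=> //.
by move: xl; rewrite mem_filter mem_iota add1n ltnS => /andP [].
Qed.

End Cosets.

(** * Counting the leaders up to d *)

Lemma count_leq_iota d a w : count (fun x => x <= d) (iota a w) = minn w (d.+1 - a).
Proof.
elim: w a => [|w IH] a /=; first by rewrite min0n.
by rewrite IH; case: leqP; lia.
Qed.

Lemma count_not_dvdn q d : 0 < q ->
  count (fun x => ~~ (q %| x)) (iota 1 d) = d - d %/ q.
Proof.
move=> q0; elim: d => [|d IH] //.
have -> : iota 1 d.+1 = iota 1 d ++ [:: d.+1] by rewrite -(addn1 d) iotaD add1n addn1.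
rewrite count_cat IH /= addn0.
rewrite divnS //; have := leq_div d q.
by case: (q %| d.+1); lia.
Qed.

(** Identifies the ceiling of [d] times 1 - 1/q with the number of integers in [1, d] not divisible
    by [q]. *)
Lemma ceil_div_pred q d : 0 < q -> ceil_div (d * (q - 1)) q = d - d %/ q.
Proof.
move=> q0; rewrite /ceil_div.
have dE := divn_eq d q; have dr := ltn_pmod d q0.
have -> : d * (q - 1) + q - 1 = (d - d %/ q) * q + (q - 1 - d %% q).
  rewrite mulnBl mulnBr muln1; have h1 := leq_pmulr d q0.
  have h2 : d %/ q * q <= d * q by rewrite leq_mul2r leq_div orbT.
  move: dE dr h2; move: (d %/ q * q) (d %% q) (d * q) h1 => c r e.
  by clear - q0; lia.
rewrite divnMDl // [X in _ + X]divn_small ?addn0 //.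
by rewrite -subnDA ltn_subrL add1n.
Qed.

Section Count.
Variables (q lam Q A B : nat).
Hypotheses (q3 : 3 <= q) (qQ : q ^ 2 <= Q) (q_dvdQ : q %| Q) (lam2 : 2 <= lam)
  (lam_Q : lam %| Q - 1)
  (AE : A * lam = q * Q + 1) (BE : B * lam = 2 * (Q - 1)).
Local Notation r1 := ((q - 1) %/ lam).
Local Notation r3 := ((q - 3) %/ lam).
Local Notation lo := (A - q %/ lam).
Local Notation hi := (A + (q - 2) %/ lam).
Local Notation kappa := (2 * A - (2 * q + 1) %/ lam).
Local Notation lead := (leader q lam Q).

Let lam0 : 0 < lam. Proof. exact: ltnW. Qed.
Let q0 : 0 < q. Proof. exact: leq_trans q3. Qed.
Let Qq : 3 * q <= Q.
Proof. by apply: leq_trans qQ; rewrite -mulnn leq_mul2r q3 orbT. Qed.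
Let Q9 : 9 <= Q. Proof. by clear - Qq q3; lia. Qed.
Let qQ3 : 3 * Q <= q * Q. Proof. by rewrite leq_mul2r q3 orbT. Qed.

(** Places each [A + B + i * Q] before [A + i.+1 * Q], so that the two progressions alternate. *)
Let BQ : B < Q.
Proof.
rewrite -(ltn_pmul2r lam0) BE; apply: leq_trans (_ : Q * 2 <= _).
  by clear - Q9; lia.
by rewrite leq_mul2l lam2 orbT.
Qed.

Let lo_gt0 : 0 < lo.
Proof.
rewrite subn_gt0 -(ltn_pmul2r lam0) AE; apply: leq_ltn_trans (leq_divM _ _) _.
by clear - Qq qQ3 q3; lia.
Qed.

Let hiQ : hi < A + Q.
Proof.
by rewrite ltn_add2l; apply: leq_ltn_trans (leq_div _ _) _; clear - Qq q3; lia.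
Qed.

Let hiB : hi < A + B.
Proof.
rewrite ltn_add2l -(ltn_pmul2r lam0) BE; apply: leq_ltn_trans (leq_divM _ _) _.
by clear - Qq q3; lia.
Qed.

Let kappaE : kappa * lam + (2 * q + 1) >= 2 * (q * Q) + 2.
Proof.
rewrite mulnBl -mulnA AE; have := leq_divM (2 * q + 1) lam; clear; lia.
Qed.

Lemma plus_lt_kappa i : i <= r1 -> A + i * Q < kappa.
Proof.
move=> ir; have iq : i * lam <= q - 1 by rewrite -(leq_divRL _ _ lam0).
have iQ : i * lam * Q <= (q - 1) * Q by rewrite leq_mul2r iq orbT.
rewrite mulnBl in iQ.
rewrite -(ltn_pmul2r lam0) mulnDl AE mulnAC.
by clear - iQ kappaE Qq q3 qQ3; lia.
Qed.

Lemma minus_lt_kappa i : i <= r3 -> A + B + i * Q < kappa.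
Proof.
move=> ir; have iq : i * lam <= q - 3 by rewrite -(leq_divRL _ _ lam0).
have iQ : i * lam * Q <= (q - 3) * Q by rewrite leq_mul2r iq orbT.
rewrite mulnBl in iQ.
rewrite -(ltn_pmul2r lam0) !mulnDl AE BE mulnAC.
by clear - iQ kappaE Qq q3 qQ3; lia.
Qed.

Lemma hi_lt_kappa : hi < kappa.
Proof.
apply: (ltn_trans hiB); have := @minus_lt_kappa 0; rewrite mul0n addn0; exact.
Qed.

(** The exceptional values below [kappa], listed block first and then by progression, so that each
    piece is counted separately. *)
Let exceptional_list := iota lo (hi.+1 - lo) ++
  ([seq A + i * Q | i <- iota 1 r1] ++ [seq A + B + i * Q | i <- iota 0 r3.+1]).

Let Q0 : 0 < Q. Proof. exact: leq_trans Q9. Qed.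

Lemma mem_exceptional_list x : x < kappa ->
  (x \in exceptional_list) = exceptional q lam Q x.
Proof.
move=> xk; rewrite (exceptionalE lam2 AE BE) // !mem_cat mem_iota.
rewrite subnKC; last by apply: leqW; rewrite (leq_trans (leq_subr _ _)) ?leq_addr.
rewrite ltnS (leqNgt kappa) xk orbF; congr (_ || (_ || _)).
  by apply/mapP/hasP => -[i ir /eqP E]; exists i => //; apply/eqP.
by apply/mapP/hasP => -[i ir /eqP E]; exists i => //; apply/eqP.
Qed.

(** The block ends before either progression starts, and modulo [Q] the progressions differ by [B],
    which is strictly between 0 and [Q]. *)
Lemma uniq_exceptional_list : uniq exceptional_list.
Proof.
have inj c : injective (fun i => c + i * Q).
  by move=> i j /addnI /eqP; rewrite eqn_pmul2r // => /eqP.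
rewrite !cat_uniq (map_inj_uniq (inj A)) (map_inj_uniq (inj (A + B))) !iota_uniq andbT.
rewrite andTb; apply/andP; split.
  apply/hasPn => x; rewrite mem_cat mem_iota negb_and -ltnNge -leqNgt => H.
  apply/orP; right; rewrite subnKC; last first.
    by apply: leqW; rewrite (leq_trans (leq_subr _ _)) ?leq_addr.
  case/orP: H => /mapP [i]; rewrite mem_iota => /andP [i1 _] ->.
    by apply: leq_trans hiQ _; rewrite leq_add2l leq_pmull.
  by apply: leq_trans hiB _; rewrite leq_addr.
apply/hasPn => x /mapP [i _ ->]; apply/mapP => -[j _ /eqP].
rewrite -addnA eqn_add2l => /eqP H.
have Bp : 0 < B.
  by rewrite -(ltn_pmul2r lam0) BE; clear - Q9; lia.
have := congr1 (modn^~ Q) H; rewrite addnC modnMDl modnMl modn_small //.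
by move: Bp; clear; lia.
Qed.

(** Ensures that no value is discarded twice. In the block the only multiple of [q] that [x * lam]
    can be is [q * Q], and then [lam] would divide [Q] as well as [Q - 1]; on the progressions
    [x * lam] is 1 or -1 modulo [q]. *)
Lemma exceptional_list_coprime x : x \in exceptional_list -> ~~ (q %| x).
Proof.
rewrite !mem_cat => /or3P [].
- rewrite mem_iota subnKC; last by apply: leqW; rewrite (leq_trans (leq_subr _ _)) ?leq_addr.
  rewrite ltnS => /andP [H1 H2]; apply/negP => qx.
  have K1 : q * Q + 1 <= x * lam + q.
    rewrite -AE; apply: leq_trans (_ : x * lam + (q %/ lam) * lam <= _).
      by rewrite -mulnDl leq_pmul2r // addnC -leq_subLR.
    by rewrite leq_add2l leq_divM.
  have K2 : x * lam <= q * Q + 1 + (q - 2).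
    rewrite -AE; apply: leq_trans (_ : A * lam + ((q - 2) %/ lam) * lam <= _).
      by rewrite -mulnDl leq_pmul2r.
    by rewrite leq_add2l leq_divM.
  case/dvdnP: qx => y yE; move: K1 K2; rewrite yE mulnAC => K1 K2.
  have yQ : y * lam = Q.
    have : y * lam < Q.+1.
      by rewrite -(ltn_pmul2r q0) mulSn (mulnC Q); clear - K2 q3; lia.
    have : Q < (y * lam).+1.
      by rewrite -(ltn_pmul2r q0) mulSn (mulnC Q); clear - K1 q3; lia.
    by clear; lia.
  have : lam %| 1.
    rewrite -(@dvdn_addr (Q - 1)) // subnK //.
    by rewrite -yQ dvdn_mull.
  by rewrite dvdn1; clear - lam2; lia.
- move=> /mapP [i _ ->]; apply/negP => qx.
  have : q %| 1.
    have d1 : q %| q * Q + i * lam * Q by rewrite !(dvdn_add, dvdn_mull).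
    rewrite -(dvdn_addr _ d1).
    have -> : q * Q + i * lam * Q + 1 = (A + i * Q) * lam.
      by rewrite mulnDl AE mulnAC; clear; lia.
    by rewrite dvdn_mulr.
  by rewrite dvdn1; clear - q3; lia.
- move=> /mapP [i _ ->]; apply/negP => qx.
  have : q %| 1.
    rewrite -(dvdn_addr _ (dvdn_mulr lam qx)).
    have -> : (A + B + i * Q) * lam + 1 = q * Q + 2 * Q + i * lam * Q.
      by rewrite !mulnDl AE BE mulnAC; clear - Q9; lia.
    by rewrite !(dvdn_add, dvdn_mull).
  by rewrite dvdn1; clear - q3; lia.
Qed.

(** The three summands count the block and the two progressions up to [d]. The second progression
    starts at [i = 0], hence the successor and the test on [d < A + B]: truncated subtraction alone
    would count its first term too early. *)
Lemma count_leader d : d < kappa ->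
  count lead (iota 1 d) + (minn (hi.+1 - lo) (d.+1 - lo) + (minn r1 ((d - A) %/ Q) +
    (if d < A + B then 0 else minn r3.+1 ((d - (A + B)) %/ Q).+1)))
  = ceil_div (d * (q - 1)) q.
Proof.
move=> dk; rewrite ceil_div_pred // -count_not_dvdn //.
have xk x : x \in iota 1 d -> x < kappa.
  by rewrite mem_iota add1n ltnS => /andP [_ xd]; apply: leq_ltn_trans dk.
have <- : count (fun x => x <= d) exceptional_list =
  (minn (hi.+1 - lo) (d.+1 - lo) + (minn r1 ((d - A) %/ Q) +
    (if d < A + B then 0 else minn r3.+1 ((d - (A + B)) %/ Q).+1))).
  rewrite !count_cat !count_map count_leq_iota; congr (_ + (_ + _)).
    transitivity (count (fun i => i <= (d - A) %/ Q) (iota 1 r1)); last first.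
      by rewrite count_leq_iota subSS subn0.
    apply: eq_in_count => i; rewrite mem_iota => /andP [i1 _] /=.
    rewrite leq_divRL //; case: (leqP A d) => dA; first by rewrite leq_subRL.
    have -> : d - A = 0 by apply/eqP; rewrite subn_eq0 ltnW.
    by rewrite leqn0 muln_eq0 !gtn_eqF // leqNgt (leq_trans dA) ?leq_addr.
  case: (ltnP d (A + B)) => dAB.
    apply/eqP; rewrite -leqn0 leqNgt -has_count; apply/hasPn => i _ /=.
    by rewrite -ltnNge (leq_trans dAB) ?leq_addr.
  transitivity (count (fun i => i <= (d - (A + B)) %/ Q) (iota 0 r3.+1)); last first.
    by rewrite count_leq_iota subn0.
  by apply: eq_count => i /=; rewrite leq_divRL // leq_subRL.
have -> : count (fun x => x <= d) exceptional_list =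
    count (fun x => ~~ (q %| x) && exceptional q lam Q x) (iota 1 d).
  rewrite -!size_filter; apply/perm_size/uniq_perm.
  - by rewrite filter_uniq ?uniq_exceptional_list.
  - by rewrite filter_uniq ?iota_uniq.
  move=> x; rewrite !mem_filter mem_iota add1n ltnS.
  apply/andP/andP => [[xd xl]|[/andP [_ ex] /andP [_ xd]]].
    have x0 : 0 < x.
      have := exceptional_list_coprime xl; case: (x) => //; by rewrite dvdn0.
    rewrite x0 xd exceptional_list_coprime // -mem_exceptional_list //.
    exact: leq_ltn_trans dk.
  by rewrite mem_exceptional_list //; apply: leq_ltn_trans dk.
elim: (iota 1 d) => //= x s IH; rewrite -IH addnACA; congr (_ + _).
by rewrite /leader; case: (q %| x); case: (exceptional _ _ _ _).
Qed.

(** Everything from [kappa] on is exceptional, so the count is frozen; this is where [tau] replaces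
    [eps]. *)
Lemma count_leader_top d : kappa <= d.+1 ->
  count lead (iota 1 d) = count lead (iota 1 (kappa - 1)).
Proof.
move=> kd; have k0 : 0 < kappa by apply: leq_ltn_trans hi_lt_kappa.
have -> : d = (kappa - 1) + (d - (kappa - 1)) by clear - kd k0; lia.
rewrite iotaD count_cat -[RHS]addn0; congr (_ + _).
apply/eqP; rewrite -leqn0 leqNgt -has_count; apply/hasPn => x.
rewrite mem_iota => /andP [xk _]; rewrite /leader negb_and !negbK.
apply/orP; right; rewrite (exceptionalE lam2 AE BE) //.
have -> : kappa <= x by move: xk; clear - k0; lia.
by rewrite !orbT.
Qed.

Lemma count_leader_low d : d < lo -> count lead (iota 1 d) = ceil_div (d * (q - 1)) q.
Proof.
move=> dl; have dA : d < A by apply: leq_trans dl (leq_subr _ _).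
rewrite -count_leader; last first.
  by apply: ltn_trans dA _; apply: leq_ltn_trans hi_lt_kappa; rewrite leq_addr.
have /eqP -> : d.+1 - lo == 0 by rewrite subn_eq0.
have /eqP -> : d - A == 0 by rewrite subn_eq0 ltnW.
by rewrite div0n !minn0 (leq_trans dA) ?leq_addr // !addn0.
Qed.

Lemma count_leader_mid d : lo <= d < hi ->
  count lead (iota 1 d) + (d.+1 - lo) = ceil_div (d * (q - 1)) q.
Proof.
move=> /andP [dl dh]; rewrite -count_leader; last exact: ltn_trans hi_lt_kappa.
rewrite (minn_idPr _); last by rewrite leq_sub2r // ltnS ltnW.
have -> : (d - A) %/ Q = 0.
  by apply: divn_small; move: (ltn_trans dh hiQ) Q0; clear; lia.
by rewrite minn0 (ltn_trans dh hiB) !addn0.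
Qed.

(** The whole block has been passed, and [p] and [r] are the numbers of terms met in the two
    progressions. *)
Lemma count_leader_high d p r : hi <= d < kappa -> minn r1 ((d - A) %/ Q) = p ->
  (if d < A + B then 0 else minn r3.+1 ((d - (A + B)) %/ Q).+1) = r ->
  count lead (iota 1 d) + ((q - 2) %/ lam + q %/ lam + 1 + p + r) =
  ceil_div (d * (q - 1)) q.
Proof.
move=> /andP [dh dk] <- <-; rewrite -count_leader //.
have -> : minn (hi.+1 - lo) (d.+1 - lo) = hi.+1 - lo.
  by apply/minn_idPl; rewrite leq_sub2r // ltnS.
(* [lo_gt0] guarantees that the subtraction inside [lo] is not truncated. *)
have -> : hi.+1 - lo = (q - 2) %/ lam + q %/ lam + 1.
  by move: lo_gt0; move: (q %/ lam) ((q - 2) %/ lam); clear; lia.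
by rewrite !addnA.
Qed.

Lemma divn_sub_eq c i d : c + i * Q <= d < c + (i + 1) * Q -> (d - c) %/ Q = i.
Proof.
move=> H; have -> : d - c = i * Q + (d - (c + i * Q)) by clear - H; lia.
by rewrite divnMDl // divn_small ?addn0 //; clear - H; lia.
Qed.

Lemma r3_le_r1 : r3 <= r1.
Proof. by apply: leq_div2r; rewrite leq_sub2l. Qed.

Lemma count_leader_after_block d : hi <= d < A + B ->
  count lead (iota 1 d) + ((q - 2) %/ lam + q %/ lam + 1) = ceil_div (d * (q - 1)) q.
Proof.
move=> /andP [dh dB]; rewrite -(@count_leader_high d 0 0) ?addn0 ?dB ?dh //.
  by apply: ltn_trans dB _; have := @minus_lt_kappa 0; rewrite addn0; apply.
have -> : (d - A) %/ Q = 0; last by rewrite minn0.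
by apply: divn_small; move: dB BQ; clear; lia.
Qed.

(** In this gap the progression from [A] has contributed the indices 1 to [a], and the one from
    [A + B] the indices 0 to [a]. *)
Lemma count_leader_minus_plus d a : a < r3 -> A + B + a * Q <= d < A + (a + 1) * Q ->
  count lead (iota 1 d) + ((q - 2) %/ lam + q %/ lam + 2 * a + 2) =
  ceil_div (d * (q - 1)) q.
Proof.
move=> ar H; rewrite -(@count_leader_high d a a.+1).
- by congr (_ + _); clear; lia.
- apply/andP; split; first by move: hiB H; clear; lia.
  have /plus_lt_kappa : a + 1 <= r1 by rewrite addn1 (leq_trans ar) ?r3_le_r1.
  by move: H; clear; lia.
- rewrite (@divn_sub_eq _ a); last by move: H; clear; lia.
  by apply/minn_idPr; apply: leq_trans r3_le_r1; apply: ltnW.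
- rewrite ltnNge (leq_trans _ (proj1 (andP H))) ?leq_addr //=.
  rewrite (@divn_sub_eq _ a); last by move: H; clear; lia.
  by apply/minn_idPr; apply: leqW.
Qed.

(** One more term of the progression from [A] has been met: both have now contributed [a + 1]
    terms. *)
Lemma count_leader_plus_minus d a : a < r3 -> A + (a + 1) * Q <= d < A + B + (a + 1) * Q ->
  count lead (iota 1 d) + ((q - 2) %/ lam + q %/ lam + 2 * a + 3) =
  ceil_div (d * (q - 1)) q.
Proof.
move=> ar H; have dB : A + B <= d.
  by apply: leq_trans (proj1 (andP H)); move: BQ; clear; lia.
rewrite -(@count_leader_high d a.+1 a.+1).
- by congr (_ + _); clear; lia.
- apply/andP; split; first by move: hiB dB; clear; lia.
  by have /minus_lt_kappa : a + 1 <= r3; [rewrite addn1 | move: H; clear; lia].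
- rewrite (@divn_sub_eq _ a.+1); last by move: H BQ; clear; lia.
  by apply/minn_idPr; apply: leq_trans r3_le_r1.
- rewrite ltnNge dB /= (@divn_sub_eq _ a); last by move: H BQ; clear; lia.
  by apply/minn_idPr; apply: leqW.
Qed.

Lemma count_leader_all_minus d p : A + B + r3 * Q <= d < kappa -> minn r1 ((d - A) %/ Q) = p ->
  count lead (iota 1 d) + ((q - 2) %/ lam + q %/ lam + p + r3 + 2) =
  ceil_div (d * (q - 1)) q.
Proof.
move=> /andP [H dk] pE; have dB : A + B <= d by apply: leq_trans H; rewrite leq_addr.
rewrite -(@count_leader_high d p r3.+1) //.
- by congr (_ + _); clear; lia.
- by rewrite dk (leq_trans (ltnW hiB)).
rewrite ltnNge dB /=; apply/minn_idPl; rewrite ltnS leq_divRL // leq_subRL //.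
Qed.

Lemma minn_r1_full d : A + r1 * Q <= d -> minn r1 ((d - A) %/ Q) = r1.
Proof.
move=> H; apply/minn_idPl; rewrite leq_divRL // leq_subRL //.
by apply: leq_trans H; rewrite leq_addr.
Qed.

End Count.

(** * Cyclic codes defined by a set of zeros *)

Local Open Scope ring_scope.

(** Multiplying by [gcdp p r] turns the divisor into [p * r] and the dividend into the gcd of
    [s * p] and [s * r]. *)
Lemma dvdp_lcmp (L : fieldType) (p r s : {poly L}) :
  p != 0 -> r != 0 -> (lcmp p r %| s) = (p %| s) && (r %| s).
Proof.
move=> p0 r0; have g0 : gcdp p r != 0 by rewrite gcdp_eq0 negb_and p0.
rewrite -(dvdp_mul2r _ _ g0) /lcmp divpK; last by rewrite dvdp_mulr // dvdp_gcdl.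
have /eqp_dvdr -> : s * gcdp p r %= gcdp (s * p) (s * r) by apply: mulp_gcdr.
by rewrite dvdp_gcd (mulrC p r) dvdp_mul2r // (mulrC r p) dvdp_mul2r // andbC.
Qed.

Lemma lcmp_neq0 (L : fieldType) (p r : {poly L}) :
  p != 0 -> r != 0 -> lcmp p r != 0.
Proof.
move=> p0 r0; rewrite /lcmp dvdp_div_eq0 ?mulf_neq0 //.
by rewrite dvdp_mulr // dvdp_gcdl.
Qed.

Lemma bch_gen_dvdp (F : fieldType) (L : fieldExtType F) (beta : L) delta b
    (p : {poly F}) :
  bch_gen beta delta b %| map_poly (in_alg L) p <->
  (forall i, (b <= i < b + delta - 1)%N -> root (map_poly (in_alg L) p) (beta ^+ i)).
Proof.
set P := map_poly _ p.
have minP i : (minPoly 1%VS (beta ^+ i) %| P) = root P (beta ^+ i).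
  apply/idP/idP => [/dvdpP [s ->]|rP].
    by rewrite rootM (root_minPoly 1%AS) orbT.
  by apply: (@minPoly_dvdp _ _ 1%AS) => //; apply/polyOver1P; exists p.
rewrite /bch_gen -(big_map (fun i => minPoly 1%VS (beta ^+ i)) xpredT id) /=.
have -> : (forall i, (b <= i < b + delta - 1)%N -> root P (beta ^+ i)) <->
          {in index_iota b (b + delta - 1), forall i, root P (beta ^+ i)}.
  by split=> H i; have := H i; rewrite mem_index_iota.
elim: (index_iota _ _) => [|i s [IH1 IH2]] /=.
  by rewrite big_nil dvd1p.
have nz j : minPoly 1%VS (beta ^+ j) != 0.
  by rewrite monic_neq0 // (monic_minPoly 1%AS).
rewrite big_cons dvdp_lcmp ?nz //; last first.
  by elim: (s) => [|j r IHr] /=; rewrite ?big_nil ?oner_eq0 // big_cons lcmp_neq0.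
rewrite minP; split.
  move=> /andP[ri /IH1 rs] j; rewrite inE => /orP[/eqP -> //|]; exact: rs.
move=> H; rewrite H ?inE ?eqxx //= IH2 // => j js; apply: H; by rewrite inE js orbT.
Qed.

(** * Frobenius and the discrete Fourier transform *)

Lemma frobenius_rmorphism (F : finFieldType) (L : fieldExtType F) :
  exists f : {rmorphism L -> L}, forall x, f x = x ^+ #|F|.
Proof.
pose f (x : L) := x ^+ #|F|.
have fA : zmod_morphism f.
  rewrite /f => x y.
  have [p _ pcharFp] := finPcharP F; rewrite (card_pprimeChar pcharFp).
  elim: (logn _ _) => [|k IHk]; first by rewrite !expr1.
  rewrite expnSr !exprM {}IHk.
  by rewrite -(pchar_lalg L) in pcharFp; rewrite -pFrobenius_autE rmorphB.
have fM : monoid_morphism f.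
  by rewrite /f; split=> [|x y]; rewrite ?exprMn ?expr1n.
pose faM := GRing.isZmodMorphism.Build _ _ f fA.
pose fmM := GRing.isMonoidMorphism.Build _ _ f fM.
pose fR : {rmorphism L -> L} := HB.pack f faM fmM.
by exists fR.
Qed.

Lemma frobenius_fixedP (F : finFieldType) (L : fieldExtType F) (x : L) :
  x ^+ #|F| = x -> exists a : F, x = a%:A.
Proof.
move=> xq; have : x \in 1%AS.
  by rewrite Fermat's_little_theorem /= dimv1 expn1 xq.
by move/vlineP.
Qed.

Lemma frobenius_fixed_poly (F : finFieldType) (L : fieldExtType F) (p : {poly L}) :
  (forall i, p`_i ^+ #|F| = p`_i) -> exists p0 : {poly F}, p = map_poly (in_alg L) p0.
Proof.
move=> pq; apply/polyOver1P/polyOverP => i.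
by have [a ->] := frobenius_fixedP (pq i); rewrite rpredZ ?memv_line.
Qed.

(** Multiplication by a unit permutes the residues modulo [n]. With [u] the order of [F], it shows
    that products and sums over a set closed under [u] are fixed by Frobenius. *)
Lemma big_ord_mulmod (T : Type) (idx : T) (op : Monoid.com_law idx) (n u : nat)
    (P : pred nat) (G : nat -> T) :
  coprime u n -> (forall i, P (i %% n)%N = P i) -> (forall i, G (i %% n)%N = G i) ->
  \big[op/idx]_(r < n | P r) G r = \big[op/idx]_(r < n | P (u * r)%N) G (u * r)%N.
Proof.
case: n => [|n] cun Pn Gn; first by rewrite !big_ord0.
pose h (r : 'I_n.+1) : 'I_n.+1 := Ordinal (ltn_pmod (u * r) (ltn0Sn n)).
have hI : injective h.
  move=> r s /(congr1 val) /= /eqP; rewrite coprime_eqmod_mul2l // => /eqP.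
  by rewrite !modn_small // => /val_inj.
rewrite (reindex_inj hI) /=; apply: eq_big => [r|r _]; last by rewrite Gn.
by rewrite Pn.
Qed.

Lemma sum_prim_root (R : fieldType) (n : nat) (z : R) (k : nat) :
  n.-primitive_root z ->
  \sum_(i < n) z ^+ (k * i) = if (n %| k)%N then n%:R else 0.
Proof.
move=> zP; case: ifP => nk.
  rewrite -[n in RHS]card_ord -sumr_const; apply: eq_bigr => i _; apply/eqP.
  by rewrite -(prim_order_dvd zP) dvdn_mulr.
have zk : z ^+ k - 1 != 0 by rewrite subr_eq0 -(prim_order_dvd zP) nk.
apply: (mulfI zk); rewrite mulr0.
under eq_bigr do rewrite exprM.
by rewrite -subrX1 -exprM mulnC exprM (prim_expr_order zP) expr1n subrr.
Qed.

Definition dft (F : fieldType) (L : fieldExtType F) (n : nat) (beta : L)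
  (c : 'rV[F]_n) (i : nat) : L := \sum_(j < n) (c 0 j)%:A * beta ^+ (i * j).

Definition zeros_code (F : finFieldType) (L : fieldExtType F) (n : nat) (beta : L)
  (Z : pred nat) : {set 'rV[F]_n} :=
  [set c | [forall r : 'I_n, Z r ==> (dft beta c r == 0)]].

Lemma dft_horner (F : fieldType) (L : fieldExtType F) (n : nat) (beta : L)
    (c : 'rV[F]_n) i :
  (map_poly (in_alg L) (rVpoly c)).[beta ^+ i] = dft beta c i.
Proof.
rewrite map_rVpoly /rVpoly horner_poly; apply: eq_bigr => j _.
by rewrite valK mxE -exprM.
Qed.

(** * Dimension and LCD property of a code given by its zeros *)

Section ZerosCode.

Variables (F : finFieldType) (L : fieldExtType F) (n : nat) (beta : L) (Z : pred nat).
Hypothesis betaP : n.-primitive_root beta.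
Hypothesis coqn : coprime #|F| n.
Hypothesis Zmod : forall i, Z (i %% n)%N = Z i.
Hypothesis Zq : forall i, Z (#|F| * i)%N = Z i.

Local Notation code := (@zeros_code F L n beta Z).

Let n_gt0 : (0 < n)%N := prim_order_gt0 betaP.

Lemma dft_mod (c : 'rV[F]_n) i : dft beta c (i %% n) = dft beta c i.
Proof.
apply: eq_bigr => j _; congr (_ * _).
by rewrite !exprM (prim_expr_mod betaP).
Qed.

Lemma zeros_codeP (c : 'rV[F]_n) :
  reflect (forall i, Z i -> dft beta c i = 0) (c \in code).
Proof.
rewrite inE; apply: (iffP forallP) => [H i Zi|H r]; last first.
  by apply/implyP => /H ->.
have := H (Ordinal (ltn_pmod i n_gt0)).
by rewrite /= Zmod Zi dft_mod => /eqP.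
Qed.

(** Fourier inversion, with [n - s] standing for [- s] so that exponents stay natural. *)
Lemma dft_inversion (c : 'rV[F]_n) (s : 'I_n) :
  \sum_(i < n) beta ^+ (i * (n - s)) * dft beta c i = n%:R * (c 0 s)%:A.
Proof.
rewrite /dft; under eq_bigr do rewrite mulr_sumr.
rewrite exchange_big /= (bigD1 s) //= [X in _ + X]big1 ?addr0.
  rewrite mulr_natl.
  transitivity (\sum_(i < n) (c 0 s)%:A : L); last by rewrite sumr_const card_ord.
  apply: eq_bigr => i _; rewrite mulrCA -exprD -mulnDr subnK 1?ltnW //.
  by rewrite mulnC exprM (prim_expr_order betaP) expr1n mulr1.
move=> j js.
under eq_bigr do rewrite mulrCA -exprD -mulnDr mulnC.
rewrite -mulr_sumr (sum_prim_root _ betaP) ifF ?mulr0 //.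
(* The number [n - s + j] lies strictly between 0 and [2 * n] and differs from [n]. *)
apply/negP => /dvdnP [k]; have := ltn_ord j; have := ltn_ord s.
have : (j : nat) <> s by move/val_inj => E; rewrite E eqxx in js.
move: (nat_of_ord j) (nat_of_ord s) => a b ab ? ? E.
have : (k < 2)%N.
  by rewrite -(ltn_pmul2r n_gt0) -E; lia.
case: k E => [|[|//]] E; lia.
Qed.

Lemma dft_inj0 (c : 'rV[F]_n) (s : 'I_n) :
  \sum_(i < n) beta ^+ (i * (n - s)) * dft beta c i = 0 -> c 0 s = 0.
Proof.
rewrite dft_inversion => /eqP.
by rewrite mulf_eq0 (negPf (prim_root_natf_neq0 betaP)) scaler_eq0 oner_eq0 orbF => /eqP.
Qed.

Let cardZ := #|[set r : 'I_n | Z r]|.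

(** Frobenius permutes the factors of the product of the ['X - beta ^+ r] over [Z], so its
    coefficients lie in [F]; divisibility is vanishing at its roots because these are distinct. *)
Lemma zeros_poly : exists g : {poly F}, size g = cardZ.+1 /\
  (forall p : {poly F}, g %| p <->
     forall r : 'I_n, Z r -> root (map_poly (in_alg L) p) (beta ^+ r)).
Proof.
pose gL : {poly L} := \prod_(r < n | Z r) ('X - (beta ^+ r)%:P).
have [f fE] := frobenius_rmorphism L.
have gf : map_poly f gL = gL.
  rewrite [RHS](@big_ord_mulmod _ _ _ n #|F| Z (fun k => 'X - (beta ^+ k)%:P)) //;
    last by move=> i; rewrite (prim_expr_mod betaP).
  rewrite rmorph_prod; apply: eq_big => [r|r _]; first by rewrite Zq.
  rewrite rmorphB /= map_polyX map_polyC; congr ('X - _%:P).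
  by rewrite mulnC exprM; apply: fE.
have [|g gE] := @frobenius_fixed_poly F L gL.
  by move=> i; rewrite -fE -coef_map gf.
exists g; split.
  rewrite -(size_map_poly (in_alg L)) -gE /gL -big_filter size_prod_XsubC.
  rewrite size_filter /cardZ cardsE cardE /enum_mem size_filter.
  by rewrite /index_enum unlock.
move=> p; rewrite -(dvdp_map (in_alg L)) -gE.
have -> : gL = \prod_(z <- [seq beta ^+ r | r : 'I_n <- enum 'I_n & Z r])
   ('X - z%:P).
  by rewrite big_map big_filter /gL [in RHS]big_enum_cond.
split=> [gp r Zr|H].
  move: gp => /dvdpP [s ->]; rewrite rootM; apply/orP; right.
  rewrite root_prod_XsubC; apply/mapP; exists r => //.
  by rewrite mem_filter Zr mem_enum.
apply: Pdiv.CommonIdomain.uniq_roots_dvdp.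
  by apply/allP => z /mapP [r]; rewrite mem_filter => /andP [Zr _] ->; apply: H.
rewrite uniq_rootsE map_inj_in_uniq ?(filter_uniq _ (enum_uniq _)) //.
move=> r s _ _ /eqP; rewrite (eq_prim_root_expr betaP) => /eqP.
by rewrite !modn_small // => /val_inj.
Qed.

Lemma zeros_code_dim : code_dim code = (n - cardZ)%N.
Proof.
have [g [sg gP]] := zeros_poly.
have cZn : (cardZ <= n)%N by rewrite -[n in (_ <= n)%N]card_ord max_card.
have inC (c : 'rV[F]_n) : (c \in code) = (g %| rVpoly c).
  apply/zeros_codeP/idP => [H|/gP H r].
    by apply/gP => r Zr; apply/rootP; rewrite dft_horner H.
  rewrite -Zmod => /(H (Ordinal (ltn_pmod r n_gt0))) /rootP.
  by rewrite dft_horner /= dft_mod.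
have g0 : g != 0 by rewrite -size_poly_gt0 sg.
have spanC : <<enum code>>%VS =i code.
  move=> c; apply/idP/idP; last by move=> cC; rewrite memv_span // mem_enum.
  rewrite inC => /coord_span ->.
  rewrite linear_sum /= -(big_enum _ _ xpredT) /=; elim/big_ind: _ => [|x y|i _].
  - by rewrite dvdp0.
  - exact: dvdp_add.
  rewrite linearZ /= -mul_polyC; apply: dvdp_mull.
  by rewrite -inC -(mem_enum code) mem_nth // -cardE.
have q1 : (1 < #|F|)%N by apply: finNzRing_gt1.
apply/eqP; rewrite -(eqn_exp2l _ _ q1) /code_dim -(card_vspace (T:='rV[F]_n)).
rewrite (eq_card spanC).
(* Codewords are the multiples of [g] of degree below [n]; the cofactors are counted. *)
pose h (u : 'rV[F]_(n - cardZ)) : 'rV[F]_n := poly_rV (g * rVpoly u).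
have hs (u : 'rV[F]_(n - cardZ)) : (size (g * rVpoly u)%R <= n)%N.
  apply: leq_trans (size_polyMleq _ _) _; rewrite sg /=.
  have : (size (rVpoly u) <= n - cardZ)%N by apply: size_poly.
  by rewrite -(leq_add2l cardZ) subnKC.
have hI : injective h.
  move=> u v /(congr1 rVpoly); rewrite !poly_rV_K ?hs // => /(mulfI g0) E.
  by rewrite -(rVpolyK u) E rVpolyK.
rewrite -[X in (_ ^ X)%N]mul1n -card_mx -(card_imset _ hI); apply/eqP.
apply: eq_card => c; rewrite inC; apply/idP/imsetP => [/dvdpP [s E]|[u _ ->]].
  have ss : (size s <= n - cardZ)%N.
    have : (size (rVpoly c) <= n)%N by apply: size_poly.
    have [->|s0] := eqVneq s 0; first by rewrite size_poly0.
    rewrite E size_mul // sg addnS /= => H.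
    by rewrite -(leq_add2r cardZ) subnK.
  by exists (poly_rV s) => //; rewrite /h poly_rV_K // mulrC -E rVpolyK.
by rewrite /h poly_rV_K // dvdp_mulr.
Qed.

(* [d] is the orthogonal projection of the [s]-th unit vector on the code,
   so pairing a codeword with it returns the coordinate [s]. *)
Lemma zeros_code_LCD : (forall i j, (n %| i + j)%N -> Z i -> Z j) -> is_LCD code.
Proof.
move=> Zsym; apply/setP => c; rewrite !inE; apply/idP/idP; last first.
  move=> /eqP ->; apply/andP; split.
    apply/forallP => r; apply/implyP => _; rewrite /dft big1 // => j _.
    by rewrite mxE scale0r mul0r.
  by apply/forallP => d; apply/implyP => _; rewrite mul0mx mxE.
move=> /andP [cC /forallP cD].
have {}cC : c \in code by rewrite inE.
have [f fE] := frobenius_rmorphism L.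
apply/eqP/rowP => s; rewrite mxE.
(* The [s]-th unit vector with its frequencies in [Z] removed, up to the factor [n]; Frobenius fixes
   it because the complement of [Z] is closed under multiplication by the order of [F]. *)
pose e (j : nat) : L := \sum_(i < n | ~~ Z i) beta ^+ (i * (j + (n - s))).
have eq_e j : e j ^+ #|F| = e j.
  rewrite -fE rmorph_sum /e.
  rewrite [in RHS](big_ord_mulmod _ (u := #|F|) (P := fun i => ~~ Z i)
    (G := fun i => beta ^+ (i * (j + (n - s))))) //.
  - apply: eq_big => [i|i _]; first by rewrite Zq.
    by rewrite fE -exprM mulnC mulnA.
  - by move=> i; rewrite Zmod.
  - by move=> i; rewrite !exprM (prim_expr_mod betaP).
have /fin_all_exists [d dE] : forall j : 'I_n, exists a : F, e j = a%:A.
  by move=> j; apply: frobenius_fixedP.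
pose dv : 'rV[F]_n := \row_j d j.
have dC : dv \in code.
  apply/zeros_codeP => k Zk; rewrite /dft.
  under eq_bigr do rewrite mxE -dE mulr_suml.
  rewrite exchange_big big1 //= => i Zi.
  (* The inner sum over [j] survives only for [k = - i] modulo [n], impossible when [k] is in the
     symmetric set [Z] and [i] is not. *)
  rewrite (eq_bigr (fun j : 'I_n => beta ^+ (i * (n - s)) * beta ^+ ((i + k) * j))).
    rewrite -mulr_sumr (sum_prim_root _ betaP) ifF ?mulr0 //.
    apply/negP => ik; move/negP: Zi; apply; apply: Zsym Zk; by rewrite addnC.
  by move=> j _; rewrite -!exprD; congr (_ ^+ _); lia.
have := cD dv; rewrite dC implyTb mxE => /eqP cd0.
(* The frequencies of [c] in [Z] vanish; the others sum to the pairing of [c] with [dv]. *)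
apply: dft_inj0; rewrite (bigID (fun i : 'I_n => Z i)) /= big1 ?add0r; last first.
  by move=> i Zi; rewrite (zeros_codeP _ cC) ?mulr0.
transitivity ((\sum_j c 0 j * dv^T j 0)%:A : L); last by rewrite cd0 scale0r.
rewrite /dft; under eq_bigr do rewrite mulr_sumr.
rewrite exchange_big -[RHS]/(in_alg L _) rmorph_sum; apply: eq_bigr => j _ /=.
rewrite !mxE -scalerA -dE /e scaler_sumr; apply: eq_bigr => i _.
by rewrite mulr_algl -scalerAr -exprD -mulnDr addnC.
Qed.

End ZerosCode.

(** * Minimum distance and zeros of BCH codes *)

Lemma dft_frobenius (F : finFieldType) (L : fieldExtType F) (n : nat) (beta : L)
    (c : 'rV[F]_n) i : dft beta c (#|F| * i) = dft beta c i ^+ #|F|.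
Proof.
have [f fE] := frobenius_rmorphism L.
rewrite -fE rmorph_sum; apply: eq_bigr => j _ /=.
rewrite [RHS]fE exprMn -[(c 0 j)%:A]/(in_alg L _) -rmorphXn expf_card.
by rewrite -exprM -mulnA mulnC.
Qed.

(* The witness is the locator polynomial of the support with one point removed:
   its degree is [hweight c - 1], so it only involves vanishing values of [dft]. *)
Lemma bch_bound (F : finFieldType) (L : fieldExtType F) (n : nat) (beta : L)
    (c : 'rV[F]_n) (b D : nat) :
  n.-primitive_root beta -> (forall k, (k < D.-1)%N -> dft beta c (b + k) = 0) ->
  c != 0 -> (D <= hweight c)%N.
Proof.
move=> betaP c0 cN0; rewrite leqNgt; apply/negP => wD.
have beta0 : beta != 0.
  have := prim_expr_order betaP; apply: contra_eq_neq => ->.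
  by rewrite expr0n eqn0Ngt (prim_order_gt0 betaP) eq_sym oner_neq0.
have [j0 cj0] : exists j, c 0 j != 0.
  apply/existsP; apply: contraNT cN0; rewrite negb_exists => /forallP H.
  by apply/eqP/rowP => j; have := H j; rewrite negbK mxE => /eqP.
set w := hweight c in wD.
pose S := [set i : 'I_n | c 0 i != 0] :\ j0.
pose f : {poly L} := \prod_(j in S) ('X - (beta ^+ j)%:P).
have Sw : (#|S|.+1 = w)%N.
  by rewrite /w /hweight [RHS](cardsD1 j0) inE cj0.
have sf : size f = w.
  by rewrite /f -big_enum size_prod_XsubC -cardE.
(* Expanding [f] by coefficients gives consecutive transform values, all zero; evaluating [f] on the
   support leaves only the nonzero term at [j0]. *)
have : \sum_(j < n) (c 0 j)%:A * beta ^+ (b * j) * f.[beta ^+ j] = 0.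
  under eq_bigr do rewrite horner_coef sf mulr_sumr.
  rewrite exchange_big big1 //= => k _.
  rewrite (eq_bigr (fun j : 'I_n => f`_k * ((c 0 j)%:A * beta ^+ ((b + k) * j)))).
    rewrite -mulr_sumr -/(dft beta c (b + k)) c0 ?mulr0 //.
    by have := ltn_ord k; lia.
  move=> j _; rewrite mulrCA -mulrA -exprM -exprD; congr (_ * (_ * _ ^+ _)); lia.
rewrite (bigD1 j0) //= big1 ?addr0 => [/eqP|j jj0].
  rewrite !mulf_eq0 scaler_eq0 oner_eq0 orbF (negPf cj0) /=.
  rewrite expf_eq0 (negPf beta0) andbF /=.
  rewrite -rootE /f -big_enum /=.
  rewrite -(big_map (fun j : 'I_n => beta ^+ j) xpredT (fun z => 'X - z%:P)).
  rewrite root_prod_XsubC => /mapP [j].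
  rewrite mem_enum !inE => /andP [jj0 _] /eqP.
  rewrite (eq_prim_root_expr betaP) !modn_small // => /eqP /val_inj E.
  by rewrite E eqxx in jj0.
have [cj|cj] := eqVneq (c 0 j) 0; first by rewrite cj scale0r !mul0r.
rewrite /f horner_prod (bigD1 j) /=; last by rewrite !inE jj0.
by rewrite hornerXsubC subrr mul0r mulr0.
Qed.

(** By Frobenius a zero at [beta ^+ j] spreads to its whole coset, so the consecutive zeros force
    all those in [Z]. *)
Lemma bch_code_zeros (F : finFieldType) (L : fieldExtType F) (n : nat) (beta : L)
    (Z : pred nat) (delta b : nat) :
  n.-primitive_root beta -> (forall i, Z (i %% n)%N = Z i) ->
  (forall j, (b <= j < b + delta - 1)%N -> Z j) ->
  (forall i, Z i -> exists j k,
     (b <= j < b + delta - 1)%N /\ i = j * #|F| ^ k %[mod n]) ->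
  bch_code n beta delta b = zeros_code n beta Z.
Proof.
move=> betaP Zmod Zb Zi; apply/setP => c; apply/idP/(zeros_codeP betaP Zmod).
  rewrite inE => /bch_gen_dvdp H i /Zi [j [k [/H /rootP]]].
  rewrite dft_horner => cj E; rewrite -(dft_mod betaP) E (dft_mod betaP).
  elim: k {E} => [|k IH]; first by rewrite muln1.
  by rewrite expnSr mulnA mulnC dft_frobenius IH expr0n; have := finNzRing_gt1 F; case: #|F|.
move=> H; rewrite inE; apply/bch_gen_dvdp => i /Zb /H ci.
by apply/rootP; rewrite dft_horner.
Qed.

(** * BCH codes for which -1 is a power of the field order modulo n *)

Section ReversibleBCH.
Variables (F : finFieldType) (L : fieldExtType F) (n m d : nat) (beta : L).
Hypotheses (betaP : n.-primitive_root beta) (m0 : (0 < m)%N)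
  (nqm : (n %| #|F| ^ m + 1)%N) (dn : (d < n)%N).

Local Notation Z := (cyclotomic_zeros #|F| m n d).
(** The zeros for [b = 0]: the residue 0 is adjoined to [Z]. *)
Let Z0 i := Z i || (n %| i)%N.

Let cqn : coprime #|F| n := coprime_dvd_expS m0 nqm.
Let Zmod := cyclotomic_zeros_mod #|F| m n d.
Let Zq := cyclotomic_zeros_mulq d m0 nqm.

Let Z0mod i : Z0 (i %% n)%N = Z0 i.
Proof. by rewrite /Z0 Zmod /dvdn modn_mod. Qed.

Let Z0q i : Z0 (#|F| * i)%N = Z0 i.
Proof. by rewrite /Z0 Zq Gauss_dvdr // coprime_sym. Qed.

Let Z_small j : (0 < j <= d)%N -> Z j.
Proof. by move=> jd; apply/(cyclotomic_zerosP _ m0 nqm); exists j, 0%N; rewrite muln1. Qed.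

Let code1 : bch_code n beta d.+1 1 = zeros_code n beta Z.
Proof.
apply: (bch_code_zeros betaP Zmod) => [j jd|i /(cyclotomic_zerosP _ m0 nqm) [j [k [jd E]]]].
  by apply: Z_small; lia.
by exists j, k; split=> //; lia.
Qed.

Let code0 : bch_code n beta d.+2 0 = zeros_code n beta Z0.
Proof.
apply: (bch_code_zeros betaP Z0mod) => [j jd|i].
  rewrite /Z0; case: j jd => [|j] jd; first by rewrite dvdn0 orbT.
  by rewrite Z_small //; lia.
case/orP => [/(cyclotomic_zerosP _ m0 nqm) [j [k [jd E]]]|ni].
  by exists j, k; split=> //; lia.
by exists 0%N, 0%N; split; [lia|rewrite mul0n mod0n; apply/eqP].
Qed.

Lemma bch_code1_LCD : is_LCD (bch_code n beta d.+1 1).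
Proof.
rewrite code1; apply: (zeros_code_LCD betaP cqn Zmod Zq).
by move=> i j; apply: (cyclotomic_zeros_sym m0 nqm).
Qed.

Lemma bch_code1_dist : min_dist_ge (bch_code n beta d.+1 1) d.+1.
Proof.
move=> c; rewrite code1 => /(zeros_codeP betaP Zmod) cZ c0.
apply: (bch_bound (b := 1) betaP _ c0) => k kd; apply: cZ; apply: Z_small.
by move: kd => /=; lia.
Qed.

Lemma bch_code1_dim : code_dim (bch_code n beta d.+1 1) = (n - #|[set r : 'I_n | Z r]|)%N.
Proof. by rewrite code1 (zeros_code_dim betaP cqn Zmod Zq). Qed.

Lemma bch_code0_LCD : is_LCD (bch_code n beta d.+2 0).
Proof.
rewrite code0; apply: (zeros_code_LCD betaP cqn Z0mod Z0q) => i j nij.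
case/orP => [Zi|ni]; apply/orP; first by left; apply: cyclotomic_zeros_sym Zi.
by right; rewrite -(dvdn_addr _ ni).
Qed.

Lemma bch_code0_dist : min_dist_ge (bch_code n beta d.+2 0) (2 * d.+1).
Proof.
move=> c; rewrite code0 => /(zeros_codeP betaP Z0mod) cZ c0.
(* The window of [2 * d + 1] zeros from [- d] to [d], shifted by [n]. *)
apply: (bch_bound (b := n - d) betaP _ c0) => k kd; apply: cZ; rewrite /Z0.
have [kd'|kd'|->] := ltngtP k d.
- rewrite (cyclotomic_zeros_sym m0 nqm (i := (d - k)%N)) //.
    have -> : (d - k + (n - d + k) = n)%N by clear - kd' dn; lia.
    exact: dvdnn.
  by apply: Z_small; clear - kd'; lia.
- rewrite -Zmod; have -> : (n - d + k = n + (k - d))%N by clear - kd' dn; lia.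
  rewrite modnDl Zmod Z_small //; move: kd => /=; clear - kd'; lia.
- by rewrite subnK ?dvdnn ?orbT // ltnW.
Qed.

Lemma bch_code0_dim :
  (code_dim (bch_code n beta d.+2 0)).+1 = code_dim (bch_code n beta d.+1 1).
Proof.
have n0 : (0 < n)%N by apply: leq_ltn_trans dn.
rewrite bch_code1_dim code0 (zeros_code_dim betaP cqn Z0mod Z0q).
pose o := Ordinal n0.
have -> : [set r : 'I_n | Z0 r] = o |: [set r : 'I_n | Z r].
  apply/setP => r; rewrite !inE orbC /Z0; congr (_ || _).
  have [-> /=|ro] := eqVneq r o; first by rewrite dvdn0.
  have r0 : (0 < r)%N by rewrite lt0n; apply: contra ro => /eqP r0; apply/eqP/val_inj.
  by apply/negbTE/negP => /(dvdn_leq r0); rewrite leqNgt ltn_ord.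
have oZ : o \notin [set r : 'I_n | Z r].
  by rewrite inE; apply: cyclotomic_zeros0 dn.
rewrite cardsU1 oZ add1n subnSK //.
have := subset_leq_card (subsetT (o |: [set r : 'I_n | Z r])).
by rewrite cardsU1 oZ cardsT card_ord.
Qed.

End ReversibleBCH.

(** * Divisibility by lam *)

Section Arithmetic.
Variables (q lam t : nat).
Hypotheses (lam_q : (lam %| q + 1)%N) (t_even : ~~ odd t) (q0 : (0 < q)%N).

(** Modulo [lam], [q] is -1 and [t] is even; concretely [lam] divides [q ^ 2 - 1], which divides
    [q ^ t - 1]. *)
Lemma dvdn_even_exp_pred : (lam %| q ^ t - 1)%N.
Proof.
have -> : t = (2 * t./2)%N by rewrite mul2n even_halfK.
rewrite expnM subn1; apply: dvdn_trans (dvdn_pred_predX _ _).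
by rewrite -subn1 -(exp1n 2) subn_sqr dvdn_mull.
Qed.

Lemma dvdn_odd_expS : (lam %| q * q ^ t + 1)%N.
Proof.
have Q0 : (0 < q ^ t)%N by rewrite expn_gt0 q0.
have -> : (q * q ^ t + 1 = q * (q ^ t - 1) + (q + 1))%N.
  by rewrite mulnBr muln1 addnA subnK // leq_pmulr.
by rewrite dvdn_add // dvdn_mull // dvdn_even_exp_pred.
Qed.

Lemma dvdn_sqr_expS : (lam %| q * (q ^ t) ^ 2 + 1)%N.
Proof.
have Q0 : (0 < q ^ t)%N by rewrite expn_gt0 q0.
have -> : (q * (q ^ t) ^ 2 + 1 = q * q ^ t * (q ^ t - 1) + (q * q ^ t + 1))%N.
  by rewrite mulnBr muln1 addnA -mulnn mulnA subnK // leq_pmulr.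
by rewrite dvdn_add ?dvdn_odd_expS // dvdn_mull // dvdn_even_exp_pred.
Qed.

End Arithmetic.

(** * Assembling the parameters of the two codes *)

Theorem theorem3 (F : finFieldType) (L : fieldExtType F)
  (q lam t m n l : nat) (alpha : L) (delta : nat) :
  #|F| = q -> odd q ->
  (lam %| q + 1)%N -> (2 <= lam)%N -> (lam < q + 1)%N ->
  ~~ odd t -> m = (2 * t + 1)%N -> (5 <= m)%N ->
  n = ((q ^ m + 1) %/ lam)%N ->
  is_ord_mod n q l -> \dim {:L} = l ->
  ((q ^ l - 1)%N).-primitive_root alpha ->
  (1 <= delta - 1)%N -> (delta - 1 <= (2 * q ^ (t + 1) + 2 * q - 1) %/ lam)%N ->
  let beta := alpha ^+ ((q ^ l - 1) %/ n) in
  let C1 := bch_code n beta delta 1 in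
  let C2 := bch_code n beta delta.+1 0 in
  let k := code_dim C1 in
  let eps := ceil_div ((delta - 1) * (q - 1)) q in
  let A := ((q ^ (t + 1) + 1) %/ lam)%N in
  let B := ((2 * (q ^ t - 1)) %/ lam)%N in
  let ups := ((q - 2) %/ lam + q %/ lam)%N in
  let r3 := ((q - 3) %/ lam)%N in
  let r1 := ((q - 1) %/ lam)%N in
  let kappa := (2 * A - (2 * q + 1) %/ lam)%N in
  let tau := ceil_div ((kappa - 1) * (q - 1)) q in
  let top := ((2 * q ^ (t + 1) + 2 * q - 1) %/ lam + 1)%N in
  let N := n%:Z in let M2 := (2 * m)%:Z in
  [/\ is_LCD C1 /\ min_dist_ge C1 delta,
      is_LCD C2, (code_dim C2)%:Z = k%:Z - 1, min_dist_ge C2 (2 * delta)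
    & [/\
      (* (1) *)
      (2 <= delta <= A + B)%N ->
        [/\ (delta <= A - q %/ lam)%N -> k%:Z = N - M2 * eps%:Z,
            (A - q %/ lam < delta <= A + (q - 2) %/ lam)%N ->
              k%:Z = N - M2 * eps%:Z
                     + M2 * (delta%:Z - A%:Z + (q %/ lam)%N%:Z)
          & (A + (q - 2) %/ lam < delta <= A + B)%N ->
              k%:Z = N - M2 * (eps%:Z - ups%:Z - 1)],
      (* (2) *)
      r3 != 0%N -> (A + B < delta <= A + B + r3 * q ^ t)%N ->
        forall a : nat, (a <= r3 - 1)%N ->
          ((A + B + a * q ^ t < delta <= A + (a + 1) * q ^ t)%N ->
              k%:Z = N - M2 * (eps%:Z - ups%:Z - 2 * a%:Z - 2)) /\
          ((A + (a + 1) * q ^ t < delta <= A + B + (a + 1) * q ^ t)%N ->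
              k%:Z = N - M2 * (eps%:Z - ups%:Z - 2 * a%:Z - 3))
    & (* (3) *)
      (A + B + r3 * q ^ t < delta <= top)%N ->
        (r1 = r3 ->
          ((delta <= kappa)%N ->
              k%:Z = N - M2 * (eps%:Z - ups%:Z - 2 * r1%:Z - 2)) /\
          ((kappa < delta)%N ->
              k%:Z = N - M2 * (tau%:Z - ups%:Z - 2 * r1%:Z - 2))) /\
        (r1 = r3.+1 ->
          [/\ (delta <= A + r1 * q ^ t)%N ->
                k%:Z = N - M2 * (eps%:Z - ups%:Z - 2 * r1%:Z),
              (A + r1 * q ^ t < delta <= kappa)%N ->
                k%:Z = N - M2 * (eps%:Z - ups%:Z - 2 * r1%:Z - 1)
            & (kappa < delta)%N ->
                k%:Z = N - M2 * (tau%:Z - ups%:Z - 2 * r1%:Z - 1)])]].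
Proof.
move=> cardF q_odd lam_q lam2 lam_lt t_even mE m5 nE ordl _ alphaP d1 dtop.
move=> beta C1 C2 k eps A B ups r3 r1 kappa tau top N M2.
have q3 : (3 <= q)%N.
  have := finNzRing_gt1 F; rewrite cardF; move: q_odd; case: (q) => [|[|[|?]]] //.
have q0 : (0 < q)%N by apply: leq_trans q3.
have t2 : (2 <= t)%N by move: m5; rewrite mE; clear; lia.
have lam0 : (0 < lam)%N by apply: ltnW.
have qtS : (q ^ (t + 1) = q * q ^ t)%N by rewrite addn1 expnS.
have qmE : (q ^ m = q * (q ^ t) ^ 2)%N by rewrite mE addn1 expnS (mulnC 2) expnM.
have lam_Q := dvdn_even_exp_pred lam_q t_even.
have AE : (A * lam = q * q ^ t + 1)%N by rewrite /A qtS divnK // dvdn_odd_expS.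
have BE : (B * lam = 2 * (q ^ t - 1))%N by rewrite /B divnK // dvdn_mull.
have nlam : (n * lam = q * (q ^ t) ^ 2 + 1)%N by rewrite nE qmE divnK // dvdn_sqr_expS.
have qQ : (q ^ 2 <= q ^ t)%N by rewrite leq_exp2l //; apply: leq_trans q3.
have q_dvdQ : (q %| q ^ t)%N by apply: dvdn_exp => //; apply: leq_trans t2.
have m0 : (0 < m)%N by rewrite mE addn1.
have nqm : (n %| #|F| ^ m + 1)%N by rewrite cardF qmE -nlam dvdn_mulr.
have n0 : (0 < n)%N by case: (n) nlam => //; rewrite mul0n addn1.
have [d dE] : exists d, delta = d.+1 by exists (delta - 1)%N; move: d1; clear; lia.
have dT : (d * lam <= 2 * (q * q ^ t) + 2 * q - 1)%N.
  by move: dtop; rewrite dE subn1 /= leq_divRL // qtS.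
(* [small_bound] with [U = 0] and [W = 1] bounds [d * lam] by [n * lam]. *)
have dn : (d < n)%N.
  rewrite -(ltn_pmul2r lam0) nlam.
  have qW : (q * 1 <= q ^ t)%N by rewrite muln1 dvdn_leq // expn_gt0 q0.
  by have := small_bound q3 qQ (erefl _) qW (leq0n _) dT; rewrite muln1 addn0.
have betaP : n.-primitive_root beta.
  rewrite /beta; apply: (dvdn_prim_root alphaP); case: ordl => _ [ql _].
  by rewrite -eqn_mod_dvd ?expn_gt0 ?q0 //; apply/eqP.
have kE : k%:Z = N - M2 * (count (leader q lam (q ^ t)) (iota 1 d))%:Z.
  have cd := card_cyclotomic_zeros q3 t2 lam2 lam_q lam_Q nlam AE BE dT.
  have kZ : k = (n - #|[set r : 'I_n | cyclotomic_zeros q m n d r]|)%N.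
    by rewrite /k /C1 dE -cardF; exact: (bch_code1_dim betaP m0 nqm).
  rewrite kZ mE.
  have := max_card (mem [set r : 'I_n | cyclotomic_zeros q (2 * t + 1) n d r]).
  rewrite card_ord cd /N /M2 mE => le.
  by rewrite -subzn // PoszM.
have eps_d : eps = ceil_div (d * (q - 1)) q by rewrite /eps dE subn1.
(* In each range up to [kappa], [e] will be the number of exceptional values up to [d]. *)
have fin e (x : int) :
    (count (leader q lam (q ^ t)) (iota 1 d) + e = ceil_div (d * (q - 1)) q)%N ->
    x = eps%:Z - e%:Z -> k%:Z = N - M2 * x.
  by move=> H ->; rewrite kE eps_d -H PoszD addrK.
have fin_top e (x : int) : (kappa <= d.+1)%N ->
    (count (leader q lam (q ^ t)) (iota 1 (kappa - 1)) + e =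
      ceil_div ((kappa - 1) * (q - 1)) q)%N ->
    x = tau%:Z - e%:Z -> k%:Z = N - M2 * x.
  move=> kd H ->; rewrite kE (count_leader_top q3 qQ lam2 AE BE kd).
  by rewrite /tau -H PoszD addrK.
split.
- rewrite /C1 dE; split; first exact: (bch_code1_LCD betaP m0 nqm dn).
  exact: (bch_code1_dist betaP m0 nqm dn).
- by rewrite /C2 dE; exact: (bch_code0_LCD betaP m0 nqm dn).
- by rewrite /k /C1 /C2 dE -(bch_code0_dim betaP m0 nqm dn) intS [RHS]addrC addKr.
- by rewrite /C2 dE; exact: (bch_code0_dist betaP m0 nqm dn).
split.
- rewrite dE => /andP [_ dAB]; split.
  + move=> H; apply: (fin 0%N); last by rewrite subr0.
    by rewrite addn0; apply: (count_leader_low q3 qQ q_dvdQ lam2 lam_Q AE BE H).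
  + move=> /andP [Hl Hh]; rewrite kE eps_d.
    have <- := count_leader_mid q3 qQ q_dvdQ lam2 lam_Q AE BE (introT andP (conj Hl Hh)).
    (* The natural subtractions are not truncated, so they agree with the integer ones. *)
    have -> : d.+1%:Z - A%:Z + (q %/ lam)%N%:Z = (d.+1 - (A - q %/ lam))%N%:Z.
      have : (q %/ lam <= A)%N.
        rewrite -(leq_pmul2r lam0) AE; apply: leq_trans (leq_divM _ _) _.
        by rewrite ltnW // addn1 ltnS leq_pmulr // expn_gt0 q0.
      move: Hl; move: (q %/ lam)%N (A) => x y; clear; lia.
    by rewrite PoszD mulrDr opprD addrA subrK.
  move=> /andP [Hh _]; apply: (fin (ups + 1)%N).
    apply: (count_leader_after_block q3 qQ q_dvdQ lam2 lam_Q AE BE).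
    by rewrite dAB andbT.
  by move: (ups) (eps) => u e; clear; lia.
- move=> r30 _ a ar; have {ar} ar : (a < r3)%N by move: ar r30; clear; lia.
  rewrite dE; split=> H.
    apply: (fin (ups + 2 * a + 2)%N).
      exact: (count_leader_minus_plus q3 qQ q_dvdQ lam2 lam_Q AE BE ar H).
    by move: (ups) (eps) => u e; clear; lia.
  apply: (fin (ups + 2 * a + 3)%N).
    exact: (count_leader_plus_minus q3 qQ q_dvdQ lam2 lam_Q AE BE ar H).
  by move: (ups) (eps) => u e; clear; lia.
rewrite dE ltnS => /andP [dl _].
have r3_kappa : (A + B + r3 * q ^ t < kappa)%N.
  exact: (minus_lt_kappa q3 qQ lam2 AE BE (leqnn r3)).
have r1_kappa : (A + r1 * q ^ t < kappa)%N.
  exact: (plus_lt_kappa q3 qQ lam2 AE (leqnn r1)).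
have r3k : (A + B + r3 * q ^ t <= kappa - 1)%N by rewrite subn1 -ltnS (ltn_predK r3_kappa).
have r1k : (A + r1 * q ^ t <= kappa - 1)%N by rewrite subn1 -ltnS (ltn_predK r3_kappa).
have kpred : (kappa - 1 < kappa)%N by rewrite subn1 ltn_predL (leq_ltn_trans _ r3_kappa).
have kcount p := @count_leader_all_minus _ _ _ _ _ q3 qQ q_dvdQ lam2 lam_Q AE BE _ p
   (introT andP (conj r3k kpred)).
have dcount p dk := @count_leader_all_minus _ _ _ _ _ q3 qQ q_dvdQ lam2 lam_Q AE BE _ p
   (introT andP (conj dl dk)).
split=> r13; split.
- move=> dk; apply: (fin (ups + r1 + r3 + 2)%N).
    apply: dcount => //; apply: minn_r1_full q3 qQ _ _; rewrite -/r1 r13.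
    by apply: leq_trans dl; rewrite leq_add2r leq_addr.
  by rewrite r13; move: (ups) (eps) => u e; clear; lia.
- move=> dk; apply: (fin_top (ups + r1 + r3 + 2)%N); first exact: ltnW.
    by apply: kcount; apply: minn_r1_full q3 qQ _ _.
  by rewrite r13; move: (ups) (tau) => u e; clear; lia.
(* The last term [A + r1 * q ^ t] is not yet reached, so the progression from [A] has contributed
   only [r3] terms. *)
- move=> dr; apply: (fin (ups + r3 + r3 + 2)%N).
    apply: dcount; first by apply: leq_trans dr _; apply: leq_trans r1k (leq_subr _ _).
    rewrite (@divn_sub_eq q _ q3 qQ _ r3); first by apply/minn_idPr; rewrite -/r1 r13.
    by rewrite addn1 -r13 dr andbT (leq_trans _ dl) // leq_add2r leq_addr.
  by move: (ups) (eps) => u e; rewrite r13; clear; lia.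
- move=> /andP [dr dk]; apply: (fin (ups + r1 + r3 + 2)%N).
    by apply: dcount => //; apply: minn_r1_full q3 qQ _ _.
  by rewrite r13; move: (ups) (eps) => u e; clear; lia.
- move=> dk; apply: (fin_top (ups + r1 + r3 + 2)%N); first exact: ltnW.
    by apply: kcount; apply: minn_r1_full q3 qQ _ _.
  by rewrite r13; move: (ups) (tau) => u e; clear; lia.
Qed.
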